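(* Let $L>0$ and let $\beta,p$ be positive integers satisfying $\frac{\beta-1}{d}\ge\frac1p$. For any $\epsilon\in(0,1)$, there exists an absolute constant $C>0$ such that $$\inf_{\hat f}\ \sup_{f\in\Sigma(\beta,p,L),\,Q}\ \Pr_{f,\epsilon,Q}\left[\|\hat f-f\|_2^2\ge C\left(\wp(L)\cdot n^{-\frac{2\beta}{2\beta+d}}+\epsilon^2\right)\right]\ge\frac14,$$ where $\wp(L)$ is a non-zero polynomial function of $L$, the infimum is over all estimators $\hat f$ (measurable functions of the observations), and $Q$ ranges over all contaminations.
   Context: Write $[k]=\{1,\dots,k\}$. Fixed design: $n=N^d$ and the design points are $x_{\mathbf i}=(i_1/N,\dots,i_d/N)$ for $\mathbf i\in[N]^d$. Huber's $\epsilon$-contamination model: for an unknown $f:[0,1]^d\to\mathbb R$ one observes independent $y_{\mathbf i}$, $\mathbf i\in[N]^d$, with $y_{\mathbf i}\sim(1-\epsilon)N(f(x_{\mathbf i}),1)+\epsilon\,Q(x_{\mathbf i})$, where each $Q(x_{\mathbf i})$ is an arbitrary probability distribution on $\mathbb R$; $Q$ denotes the collection $(Q(x_{\mathbf i}))_{\mathbf i}$ and $\Pr_{f,\epsilon,Q}$ the law of the observations. Sobolev class $\Sigma(\beta,p,L)$ ($\beta\ge1$, $p\ge d$ integers): the functions $f:[0,1]^d\to\mathbb R$ with $\|D^\beta f\|_p\le L$, where $D^\beta f$ is the vector function comprised of all partial derivatives of $f$ of order $\beta$ (in the sense of distributions) and $\|\cdot\|_p$ is the $L_p$ norm on $[0,1]^d$.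 $\|g\|_2^2=\int_{[0,1]^d}|g(x)|^2dx$.
   Formalization: With an absolute C and ℘ positive, no ordinary polynomial ℘(L) works in general (e.g. d=1, β=2, where the true dependence is L^{2/5}), so ℘(L) is taken as a polynomial in a root L^{1/m}, positive for L>0; also f is required to be continuous on the cube. *)

(* Defs.v *)
From HB Require Import structures.
From mathcomp Require Import all_boot all_order all_algebra.
From mathcomp Require Import all_classical all_reals all_analysis.

Set Implicit Arguments.
Unset Strict Implicit.
Unset Printing Implicit Defensive.

Import Order.TTheory GRing.Theory Num.Theory.
Import numFieldNormedType.Exports.

Local Open Scope classical_set_scope.
Local Open Scope ring_scope.

Definition measure_matrix_display : measure_display -> measure_display.
Proof. exact. Qed.

Section matrix_measurable.
Context {d} {T : sigmaRingType d} (m n : nat).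

Definition matrix_cylinder : set (set 'M[T]_(m, n)) :=
  [set A | exists (i : 'I_m) (j : 'I_n) (B : set T),
     measurable B /\ A = (fun M : 'M[T]_(m, n) => M i j) @^-1` B].

Definition matrix_sigma_algebra : set (set 'M[T]_(m, n)) :=
  <<s matrix_cylinder >>.

Let matrix_set0 : matrix_sigma_algebra set0.
Proof. exact: sigma_algebra0. Qed.

Let matrix_setC A : matrix_sigma_algebra A -> matrix_sigma_algebra (~` A).
Proof. exact: sigma_algebraC. Qed.

Let matrix_bigcup (F : (set 'M[T]_(m, n))^nat) :
  (forall i, matrix_sigma_algebra (F i)) ->
  matrix_sigma_algebra (\bigcup_i F i).
Proof. exact: sigma_algebra_bigcup. Qed.

HB.instance Definition _ := @isMeasurable.Build (measure_matrix_display d)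
  'M[T]_(m, n) matrix_sigma_algebra matrix_set0 matrix_setC matrix_bigcup.

End matrix_measurable.

Lemma measurable_coord d (T : sigmaRingType d) m n (i : 'I_m) (j : 'I_n) :
  measurable_fun [set: 'M[T]_(m, n)] (fun M : 'M[T]_(m, n) => M i j).
Proof.
move=> _ B mB; rewrite setTI; apply: sub_sigma_algebra.
by exists i, j, B.
Qed.

Lemma measurable_fun_coordP d1 d2 (T1 : measurableType d1)
    (T2 : measurableType d2) m n (f : T1 -> 'M[T2]_(m, n)) :
  (forall i j, measurable_fun setT (fun x => f x i j)) -> measurable_fun setT f.
Proof.
move=> mf; apply: (@measurability _ _ _ _ _ _ (@matrix_cylinder _ T2 m n)) => //
   _ [_ [i [j [B [mB ->]]]] <-].
exact: mf.
Qed.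

Section product_measure_rV.
Context {R : realType}.
Implicit Types n : nat.

Definition rV_cons n (xv : R * 'rV[R]_n) : 'rV[R]_n.+1 :=
  \row_j oapp (fun k => xv.2 ord0 k) xv.1 (unlift ord0 j).

Definition rV_uncons n (v : 'rV[R]_n.+1) : measurableTypeR R * 'rV[R]_n :=
  (v ord0 ord0, \row_j v ord0 (lift ord0 j)).

Lemma rV_consK n : cancel (@rV_cons n) (@rV_uncons n).
Proof.
move=> [x v]; congr pair; first by rewrite mxE unlift_none.
by apply/rowP => j; rewrite !mxE liftK.
Qed.

Lemma measurable_rV_cons n : measurable_fun setT (@rV_cons n).
Proof.
apply: measurable_fun_coordP => i j; rewrite /rV_cons.
case: (unliftP ord0 j) => [k ->|->].
- under eq_fun do rewrite mxE liftK /=.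
  exact: (measurableT_comp (measurable_coord _ _) measurable_snd).
- under eq_fun do rewrite mxE unlift_none /=.
  exact: measurable_fst.
Qed.

Lemma measurable_rV_uncons n : measurable_fun setT (@rV_uncons n).
Proof.
apply: measurable_fun_pair; first exact: measurable_coord.
apply: measurable_fun_coordP => i j.
under eq_fun do rewrite mxE.
exact: measurable_coord.
Qed.

Section cons_measure.
Variables (n : nat) (m1 : {sigma_finite_measure set (measurableTypeR R) -> \bar R}).
Variable m2 : {sigma_finite_measure set 'rV[R]_n -> \bar R}.

Definition cons_measure : set 'rV[R]_n.+1 -> \bar R :=
  pushforward (m1 \x m2)%E (@rV_cons n).

Let cons_measure0 : cons_measure set0 = 0%E.
Proof. by rewrite /cons_measure /pushforward preimage_set0 measure0. Qed.

Let cons_measure_ge0 A : (0 <= cons_measure A)%E.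
Proof. by rewrite /cons_measure /pushforward; exact: measure_ge0. Qed.

Let cons_measure_sigma_additive : semi_sigma_additive cons_measure.
Proof.
move=> F mF tF mUF; rewrite /cons_measure /pushforward preimage_bigcup.
have mcons A : measurable A -> measurable (@rV_cons n @^-1` A).
  by move=> mA; rewrite -[X in measurable X]setTI; exact: measurable_rV_cons.
apply: measure_semi_sigma_additive.
- by move=> k; exact: mcons.
- apply/trivIsetP => /= i j _ _ ij; rewrite -preimage_setI.
  by move/trivIsetP : tF => /(_ _ _ _ _ ij) ->//; rewrite preimage_set0.
- by rewrite -preimage_bigcup; exact: mcons.
Qed.

HB.instance Definition _ := isMeasure.Build _ _ _ cons_measure
  cons_measure0 cons_measure_ge0 cons_measure_sigma_additive.

Let cons_measure_sigma_finite : sigma_finite setT cons_measure.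
Proof.
have /sigma_finiteP[F [TF ndF Foo]] := sigma_finiteT m1.
have /sigma_finiteP[G [TG ndG Goo]] := sigma_finiteT m2.
exists (fun k => @rV_uncons n @^-1` (F k `*` G k)).
  apply/esym; rewrite -subTset => v _.
  have [[a _ Fa] [b _ Gb]] : (\bigcup_k F k) (v ord0 ord0) /\
      (\bigcup_k G k) (\row_j v ord0 (lift ord0 j)) by rewrite -TF -TG.
  exists (maxn a b) => //; split.
    by move: Fa; exact/subsetPset/ndF/leq_maxl.
  by move: Gb; exact/subsetPset/ndG/leq_maxr.
move=> k; have [mF Fk] := Foo k; have [mG Gk] := Goo k; split.
  rewrite -[X in measurable X]setTI.
  by apply: measurable_rV_uncons => //; exact: measurableX.
rewrite /cons_measure /pushforward -comp_preimage.
rewrite (_ : _ \o _ = id); last by apply/funext => x /=; rewrite rV_consK.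
by rewrite preimage_id product_measure1E// lte_mul_pinfty// ge0_fin_numE.
Qed.

HB.instance Definition _ := Measure_isSigmaFinite.Build _ _ _ cons_measure
  cons_measure_sigma_finite.

End cons_measure.

Fixpoint product_measure_rV n :
    ('I_n -> {sigma_finite_measure set (measurableTypeR R) -> \bar R}) ->
    {sigma_finite_measure set 'rV[R]_n -> \bar R} :=
  match n return ('I_n -> {sigma_finite_measure set (measurableTypeR R) -> \bar R}) ->
                 {sigma_finite_measure set 'rV[R]_n -> \bar R} with
  | 0%N => fun=> dirac (0 : 'rV[R]_0)
  | k.+1 => fun m => cons_measure (m ord0)
                       (product_measure_rV (fun i => m (lift ord0 i)))
  end.

Lemma product_measure_rV_box n
    (m : 'I_n -> {sigma_finite_measure set (measurableTypeR R) -> \bar R})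
    (A : 'I_n -> set (measurableTypeR R)) : (forall i, measurable (A i)) ->
  product_measure_rV m [set v | forall i, A i (v ord0 i)] =
  (\prod_(i < n) m i (A i))%E.
Proof.
elim: n m A => [|n IHn] m A mA.
  rewrite big_ord0 /= diracE mem_set//.
  by case.
rewrite big_ord_recl /= /cons_measure /pushforward.
rewrite (_ : _ @^-1` _ =
    A ord0 `*` [set v : 'rV[R]_n | forall i, A (lift ord0 i) (v ord0 i)]).
  rewrite product_measure1E//.
    by congr (_ * _)%E; exact: IHn.
  rewrite (_ : [set v | _] = \bigcap_(i in [set: 'I_n])
      ((fun v : 'rV[R]_n => v ord0 i) @^-1` A (lift ord0 i))); last first.
    by apply/seteqP; split=> v /= vA i; [move=> _; exact: vA|exact: vA].
  apply: fin_bigcap_measurable => // i _.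
  rewrite -[X in measurable X]setTI.
  exact: (@measurable_coord _ R 1 n ord0 i measurableT _ (mA _)).
apply/seteqP; split=> -[x v] /=.
  move=> xvA; split; first by have := xvA ord0; rewrite mxE unlift_none.
  by move=> i; have := xvA (lift ord0 i); rewrite mxE liftK.
move=> [xA vA] i; rewrite mxE; case: (unliftP ord0 i) => [j ->|->] //=.
Qed.

Definition lebesgue_rV n : {sigma_finite_measure set 'rV[R]_n -> \bar R} :=
  product_measure_rV (fun=> lebesgue_measure).

End product_measure_rV.

Section huber.
Context {R : realType} (eps : R) (heps : 0 < eps < 1).

Let eps_ge0 : 0 <= eps. Proof. by case/andP: heps => /ltW. Qed.
Let epsC_ge0 : 0 <= 1 - eps.
Proof. by rewrite subr_ge0; case/andP: heps => _ /ltW. Qed.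

Definition huber_mixture (m : R) (Q : probability (measurableTypeR R) R) :
    set (measurableTypeR R) -> \bar R :=
  measure_add (mscale (NngNum epsC_ge0) (normal_prob m 1))
              (mscale (NngNum eps_ge0) Q).

HB.instance Definition _ m Q := Measure.on (huber_mixture m Q).

Let huber_mixture_setT m Q : huber_mixture m Q setT = 1%E.
Proof.
have -> : huber_mixture m Q setT =
    ((1 - eps)%:E * normal_prob m 1 setT + eps%:E * Q setT)%E.
  by rewrite /huber_mixture measure_addE.
have -> : normal_prob m 1 setT = 1%E by exact: probability_setT.
have -> : Q setT = 1%E by exact: probability_setT.
by rewrite !mule1 -EFinD subrK.
Qed.

HB.instance Definition _ m Q := @Measure_isProbability.Build _ _ R
  (huber_mixture m Q) (huber_mixture_setT m Q).

End huber.

Definition unit_cube {R : realType} d : set 'rV[R]_d :=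
  [set x | forall j, 0 <= x ord0 j <= 1].

Definition open_unit_cube {R : realType} d : set 'rV[R]_d :=
  [set x | forall j, 0 < x ord0 j < 1].

Arguments unit_cube {R} d.
Arguments open_unit_cube {R} d.

Section model.
Context {R : realType}.

(* i : {ffun 'I_d -> 'I_N} stands for the index (i_1 + 1, ..., i_d + 1) in [N]^d,
   ordinals starting at 0. *)
Definition design_point d N (i : {ffun 'I_d -> 'I_N}) : 'rV[R]_d :=
  \row_j ((i j).+1%:R / N%:R).

(* An observation vector lists the y_i along the enumeration of [N]^d. *)
Definition observations d N := 'rV[R]_#|{ffun 'I_d -> 'I_N}|.

Definition huber_law d N (eps : R) (heps : 0 < eps < 1) (f : 'rV[R]_d -> R)
    (Q : {ffun 'I_d -> 'I_N} -> probability (measurableTypeR R) R) :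
    {sigma_finite_measure set (observations d N) -> \bar R} :=
  product_measure_rV (fun k : 'I_#|{ffun 'I_d -> 'I_N}| =>
    huber_mixture heps (f (design_point (enum_val k))) (Q (enum_val k))).

(* Joint measurability in (data, point); this makes the events on the
   integrated squared loss measurable. *)
Definition estimator d N : set (observations d N -> 'rV[R]_d -> R) :=
  [set fhat | measurable_fun (setT `*` unit_cube d)
     (fun yx : observations d N * 'rV[R]_d => fhat yx.1 yx.2)].

Definition sq_L2_norm d (g : 'rV[R]_d -> R) : \bar R :=
  (\int[lebesgue_rV d]_(x in unit_cube d) (`|g x| ^+ 2)%:E)%E.

End model.
Arguments estimator {R} d N.

Section sobolev.
Context {R : realType} (d : nat).
Implicit Types (f g phi : 'rV[R]_d -> R).

Definition partial (j : 'I_d) phi : 'rV[R]_d -> R :=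
  fun x => 'D_('e_j) phi x.

Definition partials (s : seq 'I_d) phi : 'rV[R]_d -> R := foldr partial phi s.

Definition smooth phi :=
  forall s : seq 'I_d, continuous (partials s phi) /\
    forall (j : 'I_d) x, derivable (partials s phi) x 'e_j.

Definition support_of phi : set 'rV[R]_d := closure [set x | phi x != 0].

Definition test_function : set ('rV[R]_d -> R) :=
  [set phi | smooth phi /\ compact (support_of phi) /\
             support_of phi `<=` open_unit_cube d].

(* Entries of a multi-index of order b are at most b. *)
Definition multi_index (b : nat) := {ffun 'I_d -> 'I_b.+1}.

Definition order_of b (a : multi_index b) : nat := (\sum_j a j)%N.

Definition Dmulti b (a : multi_index b) phi : 'rV[R]_d -> R :=
  partials (flatten [seq nseq (a j) j | j <- enum 'I_d]) phi.

(* For test functions supported in the open cube, integrals over the closed and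
   the open cube agree. *)
Definition weak_derivative b (a : multi_index b) f g :=
  forall phi, test_function phi ->
    \int[lebesgue_rV d]_(x in unit_cube d) (f x * Dmulti a phi x) =
    (-1) ^+ order_of a *
    \int[lebesgue_rV d]_(x in unit_cube d) (g x * phi x).

(* L_p norm of the pointwise Euclidean norm of the vector of all derivatives of
   order b. *)
Definition Lp_norm_vec b (p : nat) (g : multi_index b -> 'rV[R]_d -> R) : \bar R :=
  'N[lebesgue_rV d]_(p%:R%:E)[
    (fun x => (Num.sqrt (\sum_(a | order_of a == b) g a x ^+ 2))%:E)
      \_ (unit_cube d) ].

(* Point evaluation at the design only makes sense for the continuous
   representative of a Sobolev class (it exists as soon as b * p > d), hence the
   continuity requirement. Values of f outside the cube are irrelevant. *)
Definition sobolev_ball (b p : nat) (L : R) : set ('rV[R]_d -> R) :=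
  [set f | {within unit_cube d, continuous f} /\
    exists g : multi_index b -> 'rV[R]_d -> R,
      (forall a, order_of a = b ->
         measurable_fun (unit_cube d) (g a) /\ weak_derivative a f (g a)) /\
      (Lp_norm_vec p g <= L%:E)%E].

End sobolev.

(* Main.v *)
Require Import Defs.
From HB Require Import structures.
From mathcomp Require Import all_boot all_order all_algebra.
From mathcomp Require Import all_classical all_reals all_analysis.
From mathcomp Require Import measurable_realfun zify ring lra.

(** The bound is the larger of two lower bounds, each obtained from a finite
    family of functions indexed by a hypercube.

    For [eps ^ 2], the constants [0] and [eps / 4] become indistinguishable: the
    total variation between [N(0, 1)] and [N(eps / 4, 1)] is at most [eps], so the
    contamination can absorb the difference of the two Gaussians and make both
    mixtures equal.

    For the nonparametric term the contamination is the clean noise itself. Let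
    [s ^ (2 b + d) = L ^ 2 n], so that the target is a multiple of [s ^ d / n].
    If [s < 1], two constants at distance of order [n ^ (-1/2)] suffice. Otherwise
    the cube is cut into [K ^ d] cells with [K] close to [min(s, N)], and each cell
    carries, or not, a smooth bump of height of order [L K ^ (-b)]. If [K < N],
    flipping one cell moves the vector of means by a bounded amount, and if [K = N]
    the bumps vanish at all design points. Assouad's argument then forces a fixed
    proportion of the cells to be misjudged with probability at least 1/4. *)

Set Implicit Arguments.
Unset Strict Implicit.
Unset Printing Implicit Defensive.

Import Order.TTheory GRing.Theory Num.Theory.
Import numFieldNormedType.Exports.

Local Open Scope classical_set_scope.
Local Open Scope ring_scope.

(** * Chi-square domination *)

(** [chi2_dominated k P Q] is the dual form of a bound [k] on the second moment of the density of
    [P] relative to [Q], that is, of a chi-square divergence at most [k - 1]. Stated through test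
    functions it multiplies over products by Tonelli alone, without product densities, and on events
    it reads [P(A)^2 <= k * Q(A)]. For unit Gaussians [k] is the exponential of the squared distance
    of the means, so only the sum of squared differences at the design points counts; a sum of at
    most 1/4 gives [k <= 3/2]. Then the two error probabilities on a cell add up to at least 5/8, so
    they average 5/16, which splits into the required 1/4 and a fraction 1/16 of cells that may be
    misjudged without a large loss.

    The bumps are only [b] times continuously differentiable. Polynomials times powers of a positive
    part have explicit derivatives of the same shape, and checking their weak derivatives takes only
    integration by parts along lines.

    Every factor depending on [d] and [beta] is moved into the coefficient of the polynomial, which
    leaves [C] absolute. *)

Definition chi2_dominated d (T : measurableType d) (R : realType) (k : R)
    (P Q : {measure set T -> \bar R}) :=
  forall h : T -> \bar R, measurable_fun setT h -> (forall x, (0 <= h x)%E) ->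
    ((\int[P]_x h x) * (\int[P]_x h x) <= k%:E * \int[Q]_x (h x * h x))%E.

(* AM-GM with weight s, integrated; optimising over s at the end replaces the
   Cauchy-Schwarz inequality and avoids its degenerate cases. *)
Lemma chi2_dominated_density d (T : measurableType d) (R : realType) (k : R)
    (P Q mu : {measure set T -> \bar R}) (u w v : T -> R) :
  measurable_fun setT u -> measurable_fun setT w -> measurable_fun setT v ->
  (forall x, 0 <= u x) -> (forall x, 0 < w x) -> (forall x, 0 <= v x) ->
  (forall x, u x ^+ 2 <= w x * v x) -> 0 < k ->
  (\int[mu]_x (v x)%:E <= k%:E)%E ->
  (forall h : T -> \bar R, measurable_fun setT h -> (forall x, 0 <= h x)%E ->
    \int[P]_x h x = \int[mu]_x (h x * (u x)%:E))%E ->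
  (forall h : T -> \bar R, measurable_fun setT h -> (forall x, 0 <= h x)%E ->
    \int[Q]_x h x = \int[mu]_x (h x * (w x)%:E))%E ->
  chi2_dominated k P Q.
Proof.
move=> mu_ mw mv u0 w0 v0 uwv k0 vk Pu Qw h mh h0.
have mhh : measurable_fun setT (fun x => h x * h x)%E by exact: emeasurable_funM.
have hh0 x : (0 <= h x * h x)%E by rewrite mule_ge0.
have ineq s : 0 < s ->
    (2%:E * \int[P]_x h x <= s%:E * \int[Q]_x (h x * h x) + (k / s)%:E)%E.
  move=> s0.
  have mf1 : measurable_fun setT (fun x => h x * (u x)%:E)%E.
    by apply: emeasurable_funM => //; exact/measurable_EFinP.
  have mf2 : measurable_fun setT (fun x => h x * h x * (w x)%:E)%E.
    by apply: emeasurable_funM => //; exact/measurable_EFinP.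
  have mv' : measurable_fun setT (fun x => (v x)%:E) by exact/measurable_EFinP.
  rewrite Pu// Qw// -ge0_integralZl_EFin//; last first.
    by move=> x _; rewrite mule_ge0// lee_fin.
  apply: (@le_trans _ _ (s%:E * \int[mu]_x (h x * h x * (w x)%:E)
      + s^-1%:E * \int[mu]_x (v x)%:E)%E); last first.
    apply: leeD => //; rewrite mulrC EFinM; apply: lee_wpmul2l => //.
    by rewrite lee_fin invr_ge0 ltW.
  rewrite -ge0_integralZl_EFin//; [|by move=> x _; rewrite mule_ge0// lee_fin ltW|exact: ltW].
  rewrite -ge0_integralZl_EFin//; last 2 first.
  - by move=> x _; rewrite lee_fin.
  - by rewrite invr_ge0 ltW.
  rewrite -ge0_integralD//; last 4 first.
  - by move=> x _; rewrite !mule_ge0// lee_fin ltW.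
  - exact: measurable_funeM.
  - by move=> x _; rewrite mule_ge0// lee_fin// invr_ge0 ltW.
  - exact: measurable_funeM.
  apply: ge0_le_integral => //.
  - by move=> x _; rewrite !mule_ge0// lee_fin.
  - exact: measurable_funeM.
  - by apply: emeasurable_funD; exact: measurable_funeM.
  move=> x _; move: (h0 x); case: (h x) => [r| |//].
  - rewrite lee_fin -!EFinM -EFinD lee_fin => r0.
    have sw : 0 < s * w x by rewrite mulr_gt0.
    have : 0 <= (s * w x) * (r - u x / (s * w x)) ^+ 2.
      by rewrite mulr_ge0 ?sqr_ge0// ltW.
    have -> : (s * w x) * (r - u x / (s * w x)) ^+ 2 =
        s * (r * r * w x) - 2 * (r * u x) + u x ^+ 2 / (s * w x).
      by field; rewrite !gt_eqF.
    have : u x ^+ 2 / (s * w x) <= s^-1 * v x.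
      rewrite ler_pdivrMr// (le_trans (uwv x))//.
      by rewrite [leRHS](_ : _ = w x * v x)//; field; rewrite gt_eqF.
    lra.
  (* Where [h] is infinite the right side is infinite as well, because [w] is positive
     everywhere. *)
  - move=> _; rewrite [leRHS](_ : _ = +oo%E) ?leey//.
    by rewrite mulyy gt0_mulye ?lte_fin// gt0_muley ?lte_fin// addye// -EFinM.
set X := (\int[P]_x h x)%E in ineq *; set Y := (\int[Q]_x _)%E in ineq *.
have X0 : (0 <= X)%E by exact: integral_ge0.
have Y0 : (0 <= Y)%E by exact: integral_ge0.
clearbody X Y; case: Y Y0 ineq => [y| |//]; last first.
  by move=> _ _; rewrite gt0_muley ?lte_fin// leey.
rewrite lee_fin => y0; case: X X0 => [x| |//]; last first.
  by move=> _ /(_ 1 ltr01); rewrite gt0_muley ?lte_fin.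
rewrite lee_fin le_eqVlt => /orP[/eqP <- _|x0 ineq].
  by rewrite mul0e -EFinM lee_fin mulr_ge0// ltW.
(* The weight [s = k / x] turns the bound into [2 x <= (k / x) y + x]; expressed through [x] rather
   than [y], it remains available when [y = 0]. *)
have kx : 0 < k / x by rewrite divr_gt0.
have := ineq _ kx; rewrite -!EFinM -EFinD !lee_fin.
have -> : k / (k / x) = x by field; rewrite !gt_eqF.
rewrite mulrAC => H.
have : x <= k * y / x by lra.
by rewrite ler_pdivlMr.
Qed.

Lemma chi2_dominated_refl d (T : measurableType d) (R : realType)
    (P : {measure set T -> \bar R}) (Q : probability T R) :
  (forall A, measurable A -> P A = Q A) -> chi2_dominated 1 P Q.
Proof.
move=> PQ; apply: (@chi2_dominated_density _ _ _ _ _ _ Q (cst 1) (cst 1) (cst 1)) => //=.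
- rewrite (integral_cst Q measurableT 1%E) mul1e.
  by have -> : (Q : {measure set T -> \bar R}) setT = 1%E by exact: probability_setT.
- move=> h mh h0; under [RHS]eq_integral do rewrite mule1.
  by apply: eq_measure_integral => A mA _; exact: PQ.
- by move=> h mh h0; under [RHS]eq_integral do rewrite mule1.
Qed.

Lemma eq_chi2_dominated d (T : measurableType d) (R : realType) (k : R)
    (P Q P' Q' : {measure set T -> \bar R}) :
  (forall A, measurable A -> P A = P' A) -> (forall A, measurable A -> Q A = Q' A) ->
  chi2_dominated k P Q -> chi2_dominated k P' Q'.
Proof.
move=> PP QQ PQ h mh h0; have := PQ h mh h0.
rewrite (@eq_measure_integral _ _ _ _ P' P)// => [|A mA _]; last exact: PP.
by rewrite (@eq_measure_integral _ _ _ _ Q' Q)// => A mA _; exact: QQ.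
Qed.

Lemma chi2_dominated_set d (T : measurableType d) (R : realType) (k : R)
    (P Q : {measure set T -> \bar R}) (A : set T) : measurable A ->
  chi2_dominated k P Q -> (P A * P A <= k%:E * Q A)%E.
Proof.
move=> mA /(_ (fun x => (\1_A x)%:E)).
rewrite !integral_indic// setIT => PQ.
rewrite (eq_integral (fun x => (\1_A x)%:E)) in PQ; last first.
  by move=> x _; rewrite -EFinM indicE -natrM; case: (_ \in _).
rewrite integral_indic// setIT in PQ; apply: PQ.
- by apply/measurable_EFinP; exact: measurable_indic.
- by move=> x; rewrite lee_fin.
Qed.

Lemma ge0_integral_cons_measure (R : realType) n
    (m1 : {sigma_finite_measure set (measurableTypeR R) -> \bar R})
    (m2 : {sigma_finite_measure set 'rV[R]_n -> \bar R}) (h : 'rV[R]_n.+1 -> \bar R) :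
  measurable_fun setT h -> (forall x, 0 <= h x)%E ->
  (\int[cons_measure m1 m2]_x h x =
   \int[m1]_x \int[m2]_v h (rV_cons (x, v)))%E.
Proof.
move=> mh h0.
have mcons : measurable_fun setT (@rV_cons R n : measurableTypeR R * 'rV[R]_n -> _).
  exact: measurable_rV_cons.
have mc : measurable_fun setT (fun xv : measurableTypeR R * 'rV[R]_n => h (rV_cons xv)).
  exact: measurableT_comp.
rewrite -[RHS](fubini_tonelli1 (m1 := m1) (m2 := m2) _ mc (fun=> h0 _)).
exact: (ge0_integral_pushforward mcons (m1 \x m2)%E measurableT mh).
Qed.

(** The first domination is applied to the partial integral of [h] over [P2], the second to each
    section of [h] under the outer integral over [Q1]. *)
Lemma chi2_dominated_cons (R : realType) n (k1 k2 : R)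
    (P1 Q1 : {sigma_finite_measure set (measurableTypeR R) -> \bar R})
    (P2 Q2 : {sigma_finite_measure set 'rV[R]_n -> \bar R}) :
  0 <= k1 -> 0 <= k2 ->
  chi2_dominated k1 P1 Q1 -> chi2_dominated k2 P2 Q2 ->
  chi2_dominated (k1 * k2) (cons_measure P1 P2) (cons_measure Q1 Q2).
Proof.
move=> k10 k20 PQ1 PQ2 h mh h0.
have mhh : measurable_fun setT (fun x => h x * h x)%E by exact: emeasurable_funM.
have hh0 x : (0 <= h x * h x)%E by rewrite mule_ge0.
rewrite !ge0_integral_cons_measure//.
have mc : measurable_fun setT (fun xv : measurableTypeR R * 'rV[R]_n => h (rV_cons xv)).
  by apply: measurableT_comp => //; exact: measurable_rV_cons.
have mcc : measurable_fun setT (fun xv : measurableTypeR R * 'rV[R]_n =>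
    h (rV_cons xv) * h (rV_cons xv))%E by exact: emeasurable_funM.
have mg := measurable_fun_fubini_tonelli_F (m2 := P2) _ mc (fun=> h0 _).
have mg' := measurable_fun_fubini_tonelli_F (m2 := Q2) _ mcc (fun=> hh0 _).
have g0 x : (0 <= \int[P2]_v h (rV_cons (x, v)))%E by exact: integral_ge0.
apply: le_trans (PQ1 _ mg g0) _.
rewrite EFinM -muleA; apply: lee_wpmul2l; first by rewrite lee_fin.
rewrite -ge0_integralZl_EFin//; last by move=> x _; exact: integral_ge0.
apply: ge0_le_integral => //.
- by move=> x _; exact: mule_ge0 (g0 x) (g0 x).
- exact: emeasurable_funM.
- exact: measurable_funeM.
- move=> x _; apply: PQ2 => //.
  by apply: (measurableT_comp mh); apply: (measurableT_comp (@measurable_rV_cons R n)).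
Qed.

Lemma chi2_dominated_product (R : realType) n (k : 'I_n -> R)
    (P Q : 'I_n -> {sigma_finite_measure set (measurableTypeR R) -> \bar R}) :
  (forall i, 0 <= k i) ->
  (forall i, chi2_dominated (k i) (P i) (Q i)) ->
  chi2_dominated (\prod_i k i) (product_measure_rV P) (product_measure_rV Q).
Proof.
elim: n k P Q => [|n IHn] k P Q k0 PQ.
  rewrite big_ord0; exact: (@chi2_dominated_refl _ _ _ _ (dirac (0 : 'rV[R]_0))).
rewrite big_ord_recl /=; apply: chi2_dominated_cons => //.
- by apply: prodr_ge0 => i _.
- exact: IHn.
Qed.

(** * Gaussian measures and contamination *)

(** The Radon-Nikodym derivative of the Gaussian agrees almost everywhere with [normal_pdf], since
    both have the same integral over every measurable set. *)
Lemma ge0_integral_normal_prob (R : realType) (m : R)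
    (h : measurableTypeR R -> \bar R) :
  measurable_fun setT h -> (forall x, 0 <= h x)%E ->
  (\int[normal_prob m 1]_x h x = \int[lebesgue_measure]_x (h x * (normal_pdf m 1 x)%:E))%E.
Proof.
move=> mh h0; have dom := @normal_prob_dominates R m 1.
rewrite -(Radon_Nikodym_SigmaFinite.change_of_variables dom)//.
have mRN := Radon_Nikodym_SigmaFinite.f_integrable dom.
have mpdf : measurable_fun setT (fun x : measurableTypeR R => (normal_pdf m 1 x)%:E).
  by apply/measurable_EFinP; exact: measurable_normal_pdf.
apply: ae_eq_integral => //.
- by apply: emeasurable_funM => //; exact: measurable_int mRN.
- exact: emeasurable_funM.
- apply: ae_eqe_mul2l => /=; apply: integral_ae_eq => // E _ mE.
  by rewrite -Radon_Nikodym_SigmaFinite.f_integral.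
Qed.

(** Completing the square: the squared density at [a] divided by the density at [b] is again
    Gaussian up to a factor, centred at [2 a - b]. Its total mass [exp((a - b)^2)] is the chi-square
    constant. *)
Lemma normal_pdf_sqr (R : realType) (a b x : R) :
  normal_pdf a 1 x ^+ 2 =
  normal_pdf b 1 x * (expR ((a - b) ^+ 2) * normal_pdf (2 * a - b) 1 x).
Proof.
rewrite !normal_pdfE ?oner_eq0// /normal_fun.
rewrite exprMn expr2 -[expR _ ^+ 2]expRM_natr.
rewrite [RHS](_ : _ = normal_peak 1 * normal_peak 1 *
  (expR (- (x - b) ^+ 2 / (1 ^+ 2 *+ 2)) * expR ((a - b) ^+ 2) *
   expR (- (x - (2 * a - b)) ^+ 2 / (1 ^+ 2 *+ 2)))); last by ring.
by rewrite -!expRD; congr (_ * expR _); field.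
Qed.

Lemma chi2_dominated_normal (R : realType) (a b : R) :
  chi2_dominated (expR ((a - b) ^+ 2)) (normal_prob a 1) (normal_prob b 1).
Proof.
apply: (@chi2_dominated_density _ _ _ _ _ _ lebesgue_measure
  (normal_pdf a 1) (normal_pdf b 1)
  (fun x => expR ((a - b) ^+ 2) * normal_pdf (2 * a - b) 1 x)).
- exact: measurable_normal_pdf.
- exact: measurable_normal_pdf.
- by apply: measurable_funM => //; exact: measurable_normal_pdf.
- by move=> x; exact: normal_pdf_ge0.
- move=> x; rewrite normal_pdfE ?oner_eq0// mulr_gt0 ?expR_gt0//.
  by rewrite normal_peak_gt0 ?oner_eq0.
- by move=> x; rewrite mulr_ge0 ?expR_ge0 ?normal_pdf_ge0.
- by move=> x; rewrite (normal_pdf_sqr a b).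
- exact: expR_gt0.
- under eq_integral do rewrite EFinM.
  rewrite ge0_integralZl_EFin ?integral_normal_pdf ?mule1 ?expR_ge0//.
    by move=> x _; rewrite lee_fin normal_pdf_ge0.
  by apply/measurable_EFinP; exact: measurable_normal_pdf.
- exact: ge0_integral_normal_prob.
- exact: ge0_integral_normal_prob.
Qed.

Lemma huber_mixtureE (R : realType) (eps : R) (heps : 0 < eps < 1) (m : R)
    (Q : probability (measurableTypeR R) R) A :
  huber_mixture heps m Q A = ((1 - eps)%:E * normal_prob m 1 A + eps%:E * Q A)%E.
Proof. by rewrite /huber_mixture measure_addE. Qed.

Lemma huber_mixture_normal (R : realType) (eps : R) (heps : 0 < eps < 1) (m : R) A :
  huber_mixture heps m (normal_prob m 1) A = normal_prob m 1 A.
Proof.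
case/andP: (heps) => /ltW e0 /ltW e1.
rewrite huber_mixtureE -ge0_muleDl ?lee_fin ?subr_ge0//.
by rewrite -EFinD subrK mul1e.
Qed.

(* The chi-square domination is tested against the indicator of [A] shifted by the
   large constant [c]; the cross term then carries the total variation. *)
Lemma normal_prob_tv (R : realType) (a c : R) (A : set (measurableTypeR R)) :
  0 < c -> measurable A ->
  fine (normal_prob a 1 A) - fine (normal_prob 0 1 A) <=
  (expR (a ^+ 2) - 1) * (1 + c / 2) + expR (a ^+ 2) / (2 * c).
Proof.
move=> c0 mA.
have := @chi2_dominated_normal R a 0; rewrite subr0 => /(_ (fun x => (\1_A x + c)%:E)).
have mI : measurable_fun setT (fun x : measurableTypeR R => (\1_A x)%:E : \bar R).
  by apply/measurable_EFinP; exact: measurable_indic.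
have intE (m : R) (k l : R) : 0 <= k -> 0 <= l ->
    (\int[normal_prob m 1]_x (k * \1_A x + l)%:E =
      (k * fine (normal_prob m 1 A) + l)%:E)%E.
  move=> k0 l0.
  rewrite EFinD EFinM fineK ?fin_num_measure//.
  under eq_integral do rewrite EFinD EFinM.
  rewrite ge0_integralD//; last 2 first.
  - by move=> x _; rewrite -EFinM lee_fin mulr_ge0.
  - exact: measurable_funeM.
  rewrite ge0_integralZl_EFin//.
  rewrite integral_indic// setIT; congr (_ + _)%E.
  rewrite (integral_cst (normal_prob m 1) measurableT l%:E).
  have -> : (normal_prob m 1 : {measure set _ -> \bar R}) setT = 1%E by exact: probability_setT.
  by rewrite mule1.
have c0' := ltW c0.
have -> : (\int[normal_prob a 1]_x (\1_A x + c)%:E)%E = (fine (normal_prob a 1 A) + c)%:E.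
  under eq_integral do rewrite -[\1_A _]mul1r.
  by rewrite intE// mul1r.
have -> : (\int[normal_prob 0 1]_x ((\1_A x + c)%:E * (\1_A x + c)%:E))%E =
    ((1 + 2 * c) * fine (normal_prob 0 1 A) + c * c)%:E.
  rewrite -intE ?mulr_ge0//; last by rewrite addr_ge0// mulr_ge0.
  apply: eq_integral => x _; rewrite -EFinM indicE; congr EFin.
  by case: (_ \in _) => /=; ring.
set p := fine (normal_prob a 1 A); set q := fine (normal_prob 0 1 A).
have p0 : 0 <= p by rewrite fine_ge0.
have q1 : q <= 1.
  rewrite -lee_fin /q fineK ?fin_num_measure//; exact: probability_le1.
have q0 : 0 <= q by rewrite fine_ge0.
have k1 : 1 <= expR (a ^+ 2) by rewrite -[leLHS]expR0 ler_expR sqr_ge0.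
set k := expR _ in k1 *.
have mc : measurable_fun setT (fun x : measurableTypeR R => (\1_A x + c)%:E).
  by apply/measurable_EFinP; apply: measurable_funD => //; exact: measurable_indic.
move=> /(_ mc) H.
have {H} : (p + c) * (p + c) <= k * ((1 + 2 * c) * q + c * c).
  by rewrite -!EFinM lee_fin in H; apply: H => x; rewrite lee_fin addr_ge0.
move=> H.
rewrite -(ler_pM2l (_ : 0 < 2 * c)); last by rewrite mulr_gt0.
have -> : 2 * c * ((k - 1) * (1 + c / 2) + k / (2 * c)) =
   (k - 1) * (2 * c + c ^+ 2) + k by field; rewrite gt_eqF.
(* Expanded, [H] bounds [2 c (p - q)] by [k q + 2 c (k - 1) q + (k - 1) c^2 - p^2]; it remains to
   replace [q] by 1 and to drop [p^2]. *)
have h1 : 0 <= k * (1 - q) by rewrite mulr_ge0 ?subr_ge0// (le_trans _ k1).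
have h2 : 0 <= c * ((k - 1) * (1 - q)) by rewrite !mulr_ge0 ?subr_ge0.
have h3 : 0 <= p * p by rewrite mulr_ge0.
lra.
Qed.

Lemma mnormalizeE (d : measure_display) (T : measurableType d) (R : realType) (r : R)
    (mu : {measure set T -> \bar R}) (P : probability T R) A :
  0 < r -> mu setT = r%:E -> (r%:E * mnormalize mu P A = mu A)%E.
Proof.
move=> r0 muT; rewrite /mnormalize muT /= orbF eqe gt_eqF//.
by rewrite muleCA -EFinM divff ?gt_eqF// mule1.
Qed.

(* With [jp] and [jn] the Jordan parts of [N(a, 1) - N(0, 1)], the contaminations
   are proportional to [(1 - eps) * jp] and [(1 - eps) * jn], completed by the same
   multiple of a point mass. *)
Lemma huber_mixture_indistinguishable (R : realType) (eps : R) (heps : 0 < eps < 1) :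
  exists Q0 Q1 : probability (measurableTypeR R) R, forall A, measurable A ->
    huber_mixture heps 0 Q0 A = huber_mixture heps (eps / 4) Q1 A.
Proof.
have [e0 e1] := andP heps; set a := eps / 4.
pose nu := cadd (charge_of_finite_measure (normal_prob a 1))
  (cscale (-1) (charge_of_finite_measure (normal_prob (0 : R) 1))).
have [P [N nuPN]] := Hahn_decomposition nu.
have nuE A : nu A = (normal_prob a 1 A - normal_prob 0 1 A)%E.
  by rewrite /nu /cadd /= cscaleN1.
pose jp := jordan_pos nuPN; pose jn := jordan_neg nuPN.
have fjp A : measurable A -> jp A \is a fin_num by move=> mA; exact: fin_num_measure.
have fjn A : measurable A -> jn A \is a fin_num by move=> mA; exact: fin_num_measure.
have fN m A : measurable A -> normal_prob (m : R) 1 A \is a fin_num.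
  by move=> mA; exact: fin_num_measure.
have jordan A : measurable A ->
    fine (normal_prob a 1 A) + fine (jn A) = fine (normal_prob 0 1 A) + fine (jp A).
  move=> mA.
  have H : (normal_prob a 1 A - normal_prob 0 1 A = jp A - jn A)%E.
    rewrite -nuE; apply: etrans (jordan_decomp nuPN mA) _.
    by rewrite -[X in (_ = _ + X)%E]mulN1e.
  move: H; rewrite -[normal_prob a 1 A]fineK ?fN// -[normal_prob 0 1 A]fineK ?fN//.
  by rewrite -(fineK (fjp _ mA)) -(fineK (fjn _ mA)) -!EFinB => -[]; lra.
have NT m : fine (normal_prob (m : R) 1 setT) = 1.
  by rewrite (_ : normal_prob _ _ _ = 1%E)//; exact: probability_setT.
(* The total variation distance of the two Gaussians; both Jordan parts have this mass because the
   Gaussians have equal mass. *)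
pose tau := fine (jp setT).
have jnT : fine (jn setT) = tau by have := jordan _ measurableT; rewrite !NT /tau; lra.
have tau_le : tau <= eps.
  have [[mP _] _ _ _] := nuPN.
  have -> : tau = fine (normal_prob a 1 P) - fine (normal_prob 0 1 P).
    rewrite -fineB ?fN// -nuE.
    by rewrite /tau /jp jordan_posE cjordan_posE /crestr0 mem_set//= /crestr setTI.
  (* [expR (a ^+ 2) - 1] is of order [eps^2], so a shift of order [1 / eps] makes the bound of order
     [eps]. *)
  have c0 : 0 < 2 / eps by rewrite divr_gt0.
  apply: le_trans (normal_prob_tv a c0 mP) _.
  (* From [exp(- a^2) >= 1 - a^2]: the reciprocal of [1 - t / 16] is at most [1 + t / 15] for
     [0 <= t <= 1], with [t = eps^2]. *)
  have ex : expR (a ^+ 2) <= 1 + eps ^+ 2 / 15.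
    have := expR_ge1Dx (- a ^+ 2); rewrite expRN => H.
    have a1 : a ^+ 2 <= 1 / 16 by rewrite /a; nra.
    rewrite -[leLHS]invrK -[leRHS]invrK lef_pV2 ?posrE ?invr_gt0 ?expR_gt0//; last first.
      by rewrite ltr_wpDr// divr_ge0// sqr_ge0.
    apply: le_trans H; rewrite -[leLHS]mulr1 ler_pdivrMl; last first.
      by rewrite ltr_wpDr// divr_ge0// sqr_ge0.
    rewrite /a expr_div_n; have : 0 <= eps ^+ 2 by rewrite sqr_ge0.
    have : eps ^+ 2 <= 1 by rewrite expr_le1// ltW.
    by move: (eps ^+ 2) => t; nra.
  have k0 : 0 <= 1 + 2 / eps / 2 by rewrite addr_ge0// !divr_ge0// ltW.
  apply: (@le_trans _ _ (eps ^+ 2 / 15 * (1 + 2 / eps / 2) + (1 + eps ^+ 2 / 15) / (2 * (2 / eps)))).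
    apply: lerD.
      by apply: ler_wpM2r => //; lra.
    by apply: ler_wpM2r => //; rewrite invr_ge0 mulr_ge0// ltW.
  have -> : eps ^+ 2 / 15 * (1 + 2 / eps / 2) + (1 + eps ^+ 2 / 15) / (2 * (2 / eps)) =
    eps * (eps / 15 + 1 / 15 + 1 / 4 + eps ^+ 2 / 60) by field; rewrite gt_eqF.
  rewrite ler_piMr ?ltW//; nra.
have tau0 : 0 <= tau by rewrite fine_ge0.
have epsC_ge0 : 0 <= 1 - eps by lra.
(* This weight of the point mass tops each contamination up to total mass [eps]; it is nonnegative
   because [tau <= eps]. *)
have r0 : 0 <= eps - (1 - eps) * tau by nra.
pose mu0 := measure_add (mscale (NngNum epsC_ge0) (jordan_pos nuPN))
  (mscale (NngNum r0) (dirac (0 : measurableTypeR R))).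
pose mu1 := measure_add (mscale (NngNum epsC_ge0) (jordan_neg nuPN))
  (mscale (NngNum r0) (dirac (0 : measurableTypeR R))).
have mu0E A : mu0 A = ((1 - eps)%:E * jp A +
    (eps - (1 - eps) * tau)%:E * (dirac (0%R : measurableTypeR R) A : \bar R))%E.
  by rewrite /mu0 measure_addE.
have mu1E A : mu1 A = ((1 - eps)%:E * jn A +
    (eps - (1 - eps) * tau)%:E * (dirac (0%R : measurableTypeR R) A : \bar R))%E.
  by rewrite /mu1 measure_addE.
have mu0T : mu0 setT = eps%:E.
  by rewrite mu0E diracT mule1 -[jp _]fineK ?fjp// -EFinM -EFinD -/tau; congr EFin; ring.
have mu1T : mu1 setT = eps%:E.
  by rewrite mu1E diracT mule1 -[jn _]fineK ?fjn// jnT -EFinM -EFinD; congr EFin; ring.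
exists (mnormalize mu0 (dirac (0 : measurableTypeR R))).
exists (mnormalize mu1 (dirac (0 : measurableTypeR R))).
move=> A mA; rewrite !huber_mixtureE.
rewrite [X in (_ + X = _)%E](etrans (mnormalizeE _ _ e0 mu0T) (mu0E A)).
rewrite [X in (_ = _ + X)%E](etrans (mnormalizeE _ _ e0 mu1T) (mu1E A)) !addeA.
congr (_ + _)%E; rewrite -!muleDr ?fin_num_adde_defl ?fN ?fjp ?fjn//.
congr (_ * _)%E; rewrite -[X in (X + _ = _)%E]fineK ?fN// -[X in (_ = X + _)%E]fineK ?fN//.
rewrite -(fineK (fjp _ mA)) -(fineK (fjn _ mA)) -!EFinD; congr EFin.
by have := jordan A mA; lra.
Qed.

(** * Assouad's lemma *)

Definition flip (I : finType) (k : I) (w : {ffun I -> bool}) : {ffun I -> bool} :=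
  [ffun i => (i == k) (+) w i].

Lemma flipK (I : finType) (k : I) : involutive (flip k).
Proof. by move=> w; apply/ffunP => i; rewrite !ffunE addbA addbb. Qed.

Section assouad.
Context {R : realType} d (T : measurableType d) (I : finType).
Variable P : {ffun I -> bool} -> {measure set T -> \bar R}.
Variables (loss : {ffun I -> bool} -> T -> \bar R) (cell_loss : I -> bool -> T -> \bar R).
Variable sigma : R.
Hypothesis PT : forall w, P w setT = 1%E.
Hypothesis P_flip : forall w k A, measurable A ->
  (P w A * P w A <= (3 / 2)%:E * P (flip k w) A)%E.
Hypothesis mloss : forall w, measurable_fun setT (loss w).
Hypothesis mcell_loss : forall k b, measurable_fun setT (cell_loss k b).
Hypothesis cell_loss_ge0 : forall k b y, (0 <= cell_loss k b y)%E.
Hypothesis cell_loss_le : forall (w : {ffun I -> bool}) y, (\sum_k cell_loss k (w k) y <= loss w y)%E.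
Hypothesis sigma_gt0 : 0 < sigma.
Hypothesis cell_sep : forall k y,
  ((sigma / 2)%:E <= cell_loss k true y + cell_loss k false y)%E.
Hypothesis I_gt0 : (0 < #|I|)%N.

(** The event that cell [k] is misjudged when its bit is [b]. The threshold is half of the
    separation [sigma / 2], so the two events of a cell cover [T]. *)
Let E k b : set T := [set y | ((sigma / 4)%:E <= cell_loss k b y)%E].
Let G w : set T := [set y | ((#|I|%:R * sigma / 64)%:E <= loss w y)%E].
Let p w A : R := fine (P w A).

Let measurable_E k b : measurable (E k b).
Proof. by rewrite -[E _ _]setTI; apply: emeasurable_fun_c_infty. Qed.

Let measurable_G w : measurable (G w).
Proof. by rewrite -[G _]setTI; apply: emeasurable_fun_c_infty. Qed.

Let fin_P w A : measurable A -> P w A \is a fin_num.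
Proof.
move=> mA; rewrite ge0_fin_numE//; apply: (@le_lt_trans _ _ (P w setT)).
  by apply: le_measure => //; rewrite inE.
by rewrite PT ltry.
Qed.

(* With x = p w (E k b), y the other error probability and u = 1 - x, the domination
   gives u^2 <= (3/2) y, so x + y >= 1 - u + (2/3) u^2 >= 5/8. *)
Let pair_error w k : 5 / 8 <= p w (E k (w k)) + p (flip k w) (E k (~~ w k)).
Proof.
have mC : measurable (~` E k (w k)) by exact: measurableC.
have xC : p w (~` E k (w k)) = 1 - p w (E k (w k)).
  have H : (P w (~` E k (w k)) + P w (E k (w k)) = 1)%E.
    by rewrite -(PT w) -(setvU (E k (w k))) measureU//; rewrite setICl.
  move: H; rewrite -[P w (~` _)]fineK ?fin_P// -[P w (E _ _)]fineK ?fin_P// -EFinD.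
  by move=> [] <-; rewrite addrK.
have CE : ~` E k (w k) `<=` E k (~~ w k).
  move=> y /= /negP; rewrite -ltNge => yE.
  have := cell_sep k y.
  have : (cell_loss k (w k) y + cell_loss k (~~ w k) y =
          cell_loss k true y + cell_loss k false y)%E.
    by case: (w k) => //=; rewrite addeC.
  move=> <- H; rewrite /E /= leNgt; apply/negP => yE'.
  have : ((sigma / 2)%:E < (sigma / 4)%:E + (sigma / 4)%:E)%E.
    by apply: le_lt_trans H _; exact: lteD.
  by rewrite -EFinD lte_fin; lra.
have := P_flip w k mC.
rewrite -[P w _]fineK ?fin_P// -[P (flip k w) _]fineK ?fin_P// -!EFinM lee_fin -/(p w _) xC.
have : p (flip k w) (~` E k (w k)) <= p (flip k w) (E k (~~ w k)).
  by apply: fine_le; rewrite ?fin_P//; apply: le_measure => //; rewrite inE.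
rewrite -/(p (flip k w) _).
move: (p w _) (p (flip k w) (E _ _)) (p (flip k w) (~` _)) => x y z.
have := sqr_ge0 (x - 1 / 4); rewrite expr2; lra.
Qed.

(** Off [G w] the loss is below [#|I| / 16] times [sigma / 4], and each misjudged cell costs
    [sigma / 4], so at most a sixteenth of the cells is misjudged; on [G w] the trivial count [#|I|]
    is used. Integration gives the bound. *)
Let error_count w :
  \sum_k p w (E k (w k)) <= #|I|%:R * (1 / 16 + p w (G w)).
Proof.
pose M : R := #|I|%:R.
have M0 : 0 <= M by [].
have int_lhs : (\int[P w]_y (\sum_k (\1_(E k (w k)) y)%:E) = (\sum_k p w (E k (w k)))%:E)%E.
  rewrite ge0_integral_sum//=; last first.
    by move=> k; apply/measurable_EFinP; exact: measurable_indic.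
  rewrite -sumEFin; apply: eq_bigr => k _.
  by rewrite integral_indic// setIT fineK ?fin_P.
have int_rhs : (\int[P w]_y ((M / 16)%:E + M%:E * (\1_(G w) y)%:E) =
    (M * (1 / 16 + p w (G w)))%:E)%E.
  rewrite ge0_integralD//; last 3 first.
  - by move=> y _; rewrite lee_fin divr_ge0.
  - by move=> y _; rewrite -EFinM lee_fin mulr_ge0.
  - by apply: measurable_funeM; apply/measurable_EFinP; exact: measurable_indic.
  rewrite (integral_cst (P w) measurableT (M / 16)%:E) PT mule1.
  rewrite ge0_integralZl_EFin//; last first.
    by apply/measurable_EFinP; exact: measurable_indic.
  rewrite integral_indic// setIT -[P w _]fineK ?fin_P// -EFinM -EFinD.
  by congr EFin; rewrite mulrDr mul1r.
rewrite -lee_fin -int_lhs -int_rhs; apply: ge0_le_integral => //.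
- by move=> y _; apply: sume_ge0 => k _; rewrite lee_fin.
- apply: emeasurable_sum => k; apply/measurable_EFinP; exact: measurable_indic.
- apply: emeasurable_funD => //; apply: measurable_funeM.
  by apply/measurable_EFinP; exact: measurable_indic.
move=> y _; rewrite sumEFin -EFinM -EFinD lee_fin [\1_(G w) y]indicE.
have count_le : \sum_k (\1_(E k (w k)) y : R) <= M.
  rewrite -[leRHS]mulr1 /M -sum1_card natr_sum mulr_suml ler_sum// => k _.
  by rewrite mulr1 indicE; case: (_ \in _).
case: (boolP (y \in G w)) => [_|]; first by rewrite mulr1 ler_wpDl// divr_ge0.
rewrite notin_setE /= => /negP; rewrite -ltNge => lossG.
rewrite mulr0 addr0 -(ler_pM2r (_ : 0 < sigma / 4)) ?divr_gt0//.
rewrite [leRHS](_ : _ = #|I|%:R * sigma / 64); last by rewrite /M; field.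
rewrite -lee_fin; apply: le_trans (ltW lossG); apply: le_trans (cell_loss_le w y).
rewrite mulr_suml -sumEFin; apply: lee_sum => k _; rewrite indicE.
case: (boolP (y \in E k (w k))) => [|_]; last by rewrite mul0r.
by rewrite inE mul1r.
Qed.

(** If every probability of a large loss were below 1/4, the mean number of misjudged cells would be
    below [#|I| * (1 / 16 + 1 / 4)] for each [w], whereas averaged over [w] it is at least 5/16 per
    cell. *)
Lemma assouad : exists w, ((1 / 4)%:E <=
  P w [set y | ((#|I|%:R * sigma / 64)%:E <= loss w y)%E])%E.
Proof.
apply: contrapT => /forallNP small.
have pG w : p w (G w) < 1 / 4.
  by rewrite -lte_fin /p fineK ?fin_P// ltNge; apply/negP; exact: small.
pose n : R := #|{ffun I -> bool}|%:R; pose M : R := #|I|%:R.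
have n0 : 0 < n by rewrite ltr0n card_ffun card_bool expn_gt0.
have M0 : 0 < M by rewrite ltr0n.
have upper : \sum_w \sum_k p w (E k (w k)) < n * (M * (5 / 16)).
  rewrite /n -sum1_card natr_sum mulr_suml; apply: ltr_sum.
    by apply/hasP; exists [ffun=> true] => //; rewrite mem_index_enum.
  move=> w _; apply: le_lt_trans (error_count w) _.
  by rewrite [ltRHS]mul1r ltr_pM2l//; have := pG w; lra.
have lower : n * (M * (5 / 8)) <= 2 * \sum_w \sum_k p w (E k (w k)).
  rewrite exchange_big mulr_sumr [leLHS]mulrCA.
  rewrite {1}/M -sum1_card natr_sum mulr_suml ler_sum// => k _; rewrite mul1r.
  (* The sum over [w] is doubled and one copy is reindexed by the involution [flip k], so that
     [pair_error] applies term by term. *)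
  rewrite [leRHS]mulr_natl mulr2n [X in _ <= _ + X](reindex_inj (inv_inj (flipK k))).
  rewrite -big_split /= /n -sum1_card natr_sum mulr_suml ler_sum// => w _.
  by rewrite mul1r; have := pair_error w k; rewrite ffunE eqxx /=.
lra.
Qed.

End assouad.

(** * Integration by parts on the unit cube *)

(** The sigma-algebra on row vectors is generated by the coordinates; it contains each open set
    because such a set is the countable union of the boxes with rational corners inside it. *)
Lemma open_measurable_rV (R : realType) n (U : set 'rV[R]_n) : open U -> measurable U.
Proof.
move=> oU.
pose box (ab : 'rV[rat]_n * 'rV[rat]_n) : set 'rV[R]_n :=
  [set x | forall j, ratr (ab.1 ord0 j) < x ord0 j < ratr (ab.2 ord0 j)].
have mbox ab : measurable (box ab).
  rewrite (_ : box ab = \bigcap_(j in [set: 'I_n])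
      ((fun x : 'rV[R]_n => x ord0 j) @^-1`
        `]ratr (ab.1 ord0 j), ratr (ab.2 ord0 j)[%classic)); last first.
    by apply/seteqP; split => x /= bx j; have := bx j; rewrite /= in_itv/=; [|exact].
  apply: fin_bigcap_measurable => // j _.
  rewrite -[X in measurable X]setTI.
  by apply: (@measurable_coord _ R 1 n ord0 j) => //; exact: measurable_itv.
rewrite (_ : U = \bigcup_ab (if `[< box ab `<=` U >] then box ab else set0)).
  apply: countable_bigcupT_measurable => //.
  by move=> ab; case: ifP.
apply/seteqP; split => [x Ux|x [ab _]]; last first.
  by case: ifPn => // /asboolP; exact.
have /nbhs_ballP[e /= e0 xeU] : nbhs x U by exact: open_nbhs_nbhs.
have lower j : exists q : rat, ratr q \in `]x ord0 j - e, x ord0 j[.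
  have /rat_in_itvoo[q qx] : x ord0 j - e < x ord0 j by rewrite ltrBlDr ltrDl.
  by exists q.
have upper j : exists q : rat, ratr q \in `]x ord0 j, x ord0 j + e[.
  have /rat_in_itvoo[q qx] : x ord0 j < x ord0 j + e by rewrite ltrDl.
  by exists q.
have [a ax] := choice lower; have [b bx] := choice upper.
exists (\row_j a j, \row_j b j) => //.
case: asboolP => [_ j /=|].
  have := ax j; have := bx j; rewrite !mxE !in_itv/=.
  by move=> /andP[-> _] /andP[_ ->].
case=> y /= yab; apply: xeU; split => // i j; rewrite (ord1 i).
rewrite /ball /= distrC ltr_distl.
have := ax j; have := bx j; have := yab j; rewrite !mxE !in_itv/=.
move=> /andP[y1 y2] /andP[_ h1] /andP[h2 _].
by rewrite (lt_trans h2 y1) (lt_trans y2 h1).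
Qed.

Lemma continuous_measurable_rV (R : realType) n (f : 'rV[R]_n -> R) :
  continuous f -> measurable_fun setT f.
Proof.
move=> /continuousP cf; apply: (measurability _ (RGenOpens.measurableE R)).
move=> _ [_ [a [b ->] <-]]; rewrite setTI; apply: open_measurable_rV.
exact/cf/interval_open.
Qed.

Lemma unit_cubeE (R : realType) n : unit_cube n =
  [set v : 'rV[R]_n | forall i, `[0, 1]%classic (v ord0 i)].
Proof. by apply/seteqP; split => v /= vc i; have := vc i; rewrite /= in_itv. Qed.

Lemma measurable_unit_cube (R : realType) n : measurable (@unit_cube R n).
Proof.
rewrite unit_cubeE (_ : [set v | _] = \bigcap_(j in [set: 'I_n])
    ((fun x : 'rV[R]_n => x ord0 j) @^-1` `[0, 1]%classic)); last first.
  by apply/seteqP; split => x /= bx j; have := bx j; [|exact].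
apply: fin_bigcap_measurable => // j _; rewrite -[X in measurable X]setTI.
by apply: (@measurable_coord _ R 1 n ord0 j) => //; exact: measurable_itv.
Qed.

Lemma lebesgue_rV_unit_cube (R : realType) n : lebesgue_rV n (@unit_cube R n) = 1%E.
Proof.
rewrite unit_cubeE /lebesgue_rV.
rewrite (@product_measure_rV_box R n _ (fun=> `[0, 1]%classic)) => [|i]; last first.
  exact: measurable_itv.
have H : lebesgue_measure (`[0, 1]%classic : set R) = 1%E.
  by rewrite lebesgue_measure_itv /= lte01 oppr0 adde0.
by rewrite big1.
Qed.

Lemma integrable_unit_cube (R : realType) n (f : 'rV[R]_n -> R) (M : R) :
  measurable_fun (unit_cube n) f -> (forall x, unit_cube n x -> `|f x| <= M) ->
  (lebesgue_rV n).-integrable (unit_cube n) (EFin \o f).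
Proof.
move=> mf fM.
have cube_lty : (lebesgue_rV n (@unit_cube R n) < +oo)%E.
  by rewrite lebesgue_rV_unit_cube ltry.
apply: measurable_bounded_integrable => //; first exact: measurable_unit_cube.
by exists M; split => [|y My x /fM /le_trans]; [exact: num_real|apply; exact: ltW].
Qed.

Lemma rV_cons_line0 (R : realType) n (x : R) (v : 'rV[R]_n) :
  rV_cons (x, v) = rV_cons (0, v) + x *: 'e_ord0.
Proof.
apply/rowP => i; rewrite !mxE; case: (unliftP ord0 i) => [k ->|->] /=.
  by rewrite mulr0 addr0.
by rewrite ?eqxx mulr1 add0r.
Qed.

Lemma rV_cons_line (R : realType) n (x t : R) (v : 'rV[R]_n) (j : 'I_n) :
  rV_cons (x, v + t *: 'e_j) = rV_cons (x, v) + t *: 'e_(lift ord0 j).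
Proof.
apply/rowP => i; rewrite !mxE; case: (unliftP ord0 i) => [k ->|->] /=.
  by rewrite !mxE (inj_eq lift_inj).
by rewrite mulr0 addr0.
Qed.

Lemma rV_cons_unit_cube (R : realType) n (xv : R * 'rV[R]_n) :
  unit_cube n.+1 (rV_cons xv) <-> 0 <= xv.1 <= 1 /\ unit_cube n xv.2.
Proof.
split=> [c|[c1 c2] i].
  split=> [|i]; first by have := c ord0; rewrite mxE unlift_none.
  by have := c (lift ord0 i); rewrite mxE liftK.
by rewrite mxE; case: (unliftP ord0 i) => [k _|_]; [exact: c2|].
Qed.

Lemma FTC_unit_interval (R : realType) (F f : R -> R) :
  (forall t : R, is_derive t (1 : R) F (f t)) -> continuous f ->
  (\int[lebesgue_measure]_(x in `[0%R, 1%R]) (f x)%:E = (F 1 - F 0)%:E)%E.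
Proof.
move=> dF cf; rewrite EFinB; apply: continuous_FTC2 => //.
- exact: continuous_subspaceT.
- have cF t : {for t, continuous F}.
    by apply: differentiable_continuous; apply/derivable1_diffP; have [] := dF t.
  split => [t _||]; first by have [] := dF t.
  + exact: cvg_at_right_filter (cF 0).
  + exact: cvg_at_left_filter (cF 1).
- by move=> t _; rewrite derive1E; have [_ ->] := dF t.
Qed.

(** Induction on the dimension with Fubini, splitting off the first coordinate. If [j] is another
    coordinate, the induction hypothesis applies to the slices; if [j] is the first, the fundamental
    theorem of calculus does. Differentiability and continuity are asked along lines only, so they
    pass to slices. *)
Lemma integral_partial_eq0 (R : realType) n (j : 'I_n) (G G' : 'rV[R]_n -> R) (M : R) :
  measurable_fun setT G' -> (forall x, `|G' x| <= M) ->
  (forall x (t : R), is_derive t (1 : R) (fun t : R => G (x + t *: 'e_j)) (G' (x + t *: 'e_j))) ->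
  (forall x, continuous (fun t : R => G' (x + t *: 'e_j))) ->
  (forall x, ~ open_unit_cube n x -> G x = 0) ->
  (\int[lebesgue_rV n]_(x in unit_cube n) (G' x)%:E = 0)%E.
Proof.
elim: n j G G' => [[]//|n IHn] j G G' mG' G'M dG cG' G0.
pose m1 : {sigma_finite_measure set (measurableTypeR R) -> \bar R} := lebesgue_measure.
pose m2 : {sigma_finite_measure set 'rV[R]_n -> \bar R} := lebesgue_rV n.
have mcons : measurable_fun setT (@rV_cons R n : measurableTypeR R * 'rV[R]_n -> _).
  exact: measurable_rV_cons.
pose D : set (measurableTypeR R * 'rV[R]_n) := @rV_cons R n @^-1` unit_cube n.+1.
have mD : measurable D.
  by rewrite /D -[X in measurable X]setTI; apply: mcons => //; exact: measurable_unit_cube.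
have m12D : (m1 \x m2)%E D = 1%E by exact: (@lebesgue_rV_unit_cube R n.+1).
pose g (xv : measurableTypeR R * 'rV[R]_n) : R := G' (rV_cons xv).
have mg : measurable_fun setT g by exact: measurableT_comp.
have ig : (m1 \x m2)%E.-integrable D (EFin \o g).
  have Dlty : ((m1 \x m2)%E D < +oo)%E by rewrite m12D ltry.
  apply: measurable_bounded_integrable => //; first exact: measurable_funTS.
  exists M; split=> [|y My x _]; first exact: num_real.
  by apply: le_trans (G'M _) _; exact: ltW.
have igD : (m1 \x m2)%E.-integrable setT ((EFin \o g) \_ D).
  by apply/integrable_restrict => //; rewrite setTI.
transitivity (\int[(m1 \x m2)%E]_z ((EFin \o g) \_ D) z)%E.
  rewrite -integral_mkcond.
  apply: (integral_pushforward mcons _ ig) => //; last exact: measurable_unit_cube.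
  by apply/measurable_EFinP.
have gDE x v : ((EFin \o g) \_ D) (x, v) =
    if (0 <= x <= 1) && (v \in @unit_cube R n) then (G' (rV_cons (x, v)))%:E else 0%E.
  rewrite patchE; congr (if _ then _ else _).
  apply/idP/andP => [|[x01 /set_mem vc]].
    by rewrite inE => /rV_cons_unit_cube[x01 vc]; split => //; rewrite inE.
  by rewrite inE; apply/rV_cons_unit_cube.
case: (unliftP ord0 j) => [k jk|j0].
  rewrite -(integral12_prod_meas1 igD); apply: integral0_eq => x _.
  rewrite /fubini_F; under eq_integral do rewrite gDE.
  case: (boolP (0 <= x <= 1)) => x01 /=; last by rewrite integral0.
  transitivity (\int[m2]_(v in unit_cube n) (G' (rV_cons (x, v)))%:E)%E.
    by rewrite [RHS]integral_mkcond; apply: eq_integral => v _; rewrite patchE.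
  apply: (IHn k (fun v => G (rV_cons (x, v))) (fun v => G' (rV_cons (x, v)))).
  - by apply: (measurableT_comp mG'); apply: (measurableT_comp mcons).
  - by move=> v; exact: G'M.
  - move=> v t; under eq_fun do rewrite rV_cons_line -jk.
    by rewrite rV_cons_line -jk.
  - by move=> v; under eq_fun do rewrite rV_cons_line -jk; exact: cG'.
  - move=> v nv; apply: G0 => c; apply: nv => i.
    by have := c (lift ord0 i); rewrite mxE liftK.
rewrite -(integral21_prod_meas1 igD); apply: integral0_eq => v _.
rewrite /fubini_G; under eq_integral do rewrite gDE.
case: (boolP (v \in @unit_cube R n)) => vc; last first.
  by under eq_integral do rewrite andbF; rewrite integral0.
transitivity (\int[m1]_(x in `[0%R, 1%R]) (G' (rV_cons (0, v) + x *: 'e_j))%:E)%E.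
  rewrite [RHS]integral_mkcond; apply: eq_integral => x _.
  by rewrite patchE andbT j0 -rV_cons_line0 mem_setE in_itv.
rewrite (FTC_unit_interval (F := fun t => G (rV_cons (0, v) + t *: 'e_j)))//.
(* The end points have first coordinate 0 or 1, hence lie outside the open cube. *)
rewrite j0 -!rV_cons_line0 !G0 ?subrr// => /(_ ord0); rewrite mxE unlift_none /= ltxx//.
by rewrite andbF.
Qed.

(* Differentiability along every line of direction [j], in a form that needs no
   topology on the row vectors. *)
Definition line_derive (R : realType) n (j : 'I_n) (f f' : 'rV[R]_n -> R) :=
  forall x (t : R),
    is_derive t (1 : R) (fun s : R => f (x + s *: 'e_j)) (f' (x + t *: 'e_j)).

Lemma derivable_line_derive (R : realType) n (j : 'I_n) (f : 'rV[R]_n -> R) :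
  (forall x, derivable f x 'e_j) -> line_derive j f (partial j f).
Proof.
move=> df x t.
have E : (fun h : R => h^-1 *: (((fun s : R => f (x + s *: 'e_j)) \o shift t) (h *: (1 : R))
      - f (x + t *: 'e_j))) =
    (fun h : R => h^-1 *: ((f \o shift (x + t *: 'e_j)) (h *: 'e_j) - f (x + t *: 'e_j))).
  apply/funext => h /=; congr (_ *: (f _ - _)).
  by rewrite [h *: 1]mulr1 scalerDl addrCA.
apply: DeriveDef; first by rewrite /derivable E; exact: df.
by rewrite /partial /derive E.
Qed.

(** Off its closed support [phi] vanishes on a neighbourhood, so differentiation does not enlarge
    the support. *)
Lemma test_function_partial (R : realType) n (j : 'I_n) (phi : 'rV[R]_n -> R) :
  test_function phi -> test_function (partial j phi).
Proof.
move=> [sphi [cphi subphi]].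
have csupp : closed (support_of phi) by exact: closed_closure.
have supp : support_of (partial j phi) `<=` support_of phi.
  move/closure_id : (csupp) => ->; apply: closureS => x /=.
  apply: contra_neqP => nx.
  have : \near x, phi x = (cst 0 : 'rV[R]_n -> R) x.
    have : nbhs x (~` support_of phi).
      by apply: open_nbhs_nbhs; split => //; exact: closed_openC.
    apply: filterS => y /= ny; apply/eqP; apply: contra_notT ny => py.
    exact: subset_closure.
  by move=> /(near_eq_derive 'e_j); rewrite /partial derive_cst.
split; last split.
- by move=> s; have := sphi (s ++ [:: j]); rewrite /partials foldr_cat.
- by apply: (subclosed_compact _ cphi) => //; exact: closed_closure.
- exact: subset_trans supp subphi.
Qed.

Lemma test_function_partials (R : realType) n (s : seq 'I_n) (phi : 'rV[R]_n -> R) :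
  test_function phi -> test_function (partials s phi).
Proof. by elim: s => //= j s IHs tphi; exact/test_function_partial/IHs. Qed.

Lemma test_function_eq0 (R : realType) n (phi : 'rV[R]_n -> R) x :
  test_function phi -> ~ open_unit_cube n x -> phi x = 0.
Proof.
move=> [_ [_ subphi]] nx; apply/eqP; apply: contra_notT nx => px.
by apply: subphi; exact: subset_closure.
Qed.

Lemma test_function_continuous (R : realType) n (phi : 'rV[R]_n -> R) :
  test_function phi -> continuous phi.
Proof. by move=> [/(_ [::])[]]. Qed.

Lemma test_function_bounded (R : realType) n (phi : 'rV[R]_n -> R) :
  test_function phi -> exists M, forall x, `|phi x| <= M.
Proof.
move=> tphi; have cphi := test_function_continuous tphi.
have [_ [compphi _]] := tphi.
have /compact_bounded[M [_ HM]] : compact (phi @` support_of phi).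
  by apply: continuous_compact => //; exact: continuous_subspaceT.
exists (`|M| + 1) => x; have [->|px] := eqVneq (phi x) 0.
  by rewrite normr0 addr_ge0.
apply: HM; first by rewrite (le_lt_trans (ler_norm M))// ltrDl.
by exists x => //; exact: subset_closure.
Qed.

(** The integral of the [j]-derivative of [u * phi] vanishes; [phi] alone makes the product zero off
    the open cube, so [u] is free at the boundary. *)
Lemma integration_by_parts_cube (R : realType) n (j : 'I_n)
    (u u' phi : 'rV[R]_n -> R) (M : R) :
  continuous u -> continuous u' -> line_derive j u u' ->
  (forall x, `|u x| <= M) -> (forall x, `|u' x| <= M) -> test_function phi ->
  \int[lebesgue_rV n]_(x in unit_cube n) (u x * partial j phi x) =
  - \int[lebesgue_rV n]_(x in unit_cube n) (u' x * phi x).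
Proof.
move=> cu cu' du uM u'M tphi.
have tdphi := test_function_partial j tphi.
have cphi := test_function_continuous tphi.
have cdphi := test_function_continuous tdphi.
have [N phiN] := test_function_bounded tphi.
have [N' dphiN] := test_function_bounded tdphi.
have cont2 (f g : 'rV[R]_n -> R) : continuous f -> continuous g ->
    continuous (fun x => f x * g x).
  by move=> cf cg x; apply: (@continuousM _ _ f g); [exact: cf|exact: cg].
have mul_le (a b A B : R) : `|a| <= A -> `|b| <= B -> `|a * b| <= A * B.
  by move=> aA bB; rewrite normrM ler_pM.
have i1 : (lebesgue_rV n).-integrable (unit_cube n) (EFin \o (fun x => u x * partial j phi x)).
  apply: (@integrable_unit_cube _ _ _ (M * N')).
    by apply: measurable_funTS; apply: continuous_measurable_rV; exact: cont2.
  by move=> x _; exact: mul_le.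
have i2 : (lebesgue_rV n).-integrable (unit_cube n) (EFin \o (fun x => u' x * phi x)).
  apply: (@integrable_unit_cube _ _ _ (M * N)).
    by apply: measurable_funTS; apply: continuous_measurable_rV; exact: cont2.
  by move=> x _; exact: mul_le.
apply/eqP; rewrite -addr_eq0 -RintegralD//; last exact: measurable_unit_cube.
pose G' x := u x * partial j phi x + u' x * phi x.
have cG' : continuous G'.
  move=> x; apply: (@continuousD _ _ _ (fun x => u x * partial j phi x)); exact: cont2.
suff : (\int[lebesgue_rV n]_(x in unit_cube n) (G' x)%:E = 0)%E.
  by rewrite /Rintegral => ->.
apply: (@integral_partial_eq0 _ _ j (fun x => u x * phi x) G' (M * N' + M * N)).
- exact: continuous_measurable_rV.
- by move=> x; rewrite (le_trans (ler_normD _ _))// lerD// mul_le.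
- move=> x t; have dphi : line_derive j phi (partial j phi).
    by apply: derivable_line_derive; have [/(_ [::])[]] := tphi.
  apply: is_derive_eq; first exact: is_deriveM (du x t) (dphi x t).
  by rewrite /G' [_ *: _]mulrC; congr (_ + _); rewrite [RHS]mulrC.
- move=> x t; apply: (@continuous_comp _ _ _ (fun t : R => x + t *: 'e_j) G'); last exact: cG'.
  apply: (@continuousD _ _ _ (cst x) (fun t : R => t *: 'e_j)); first exact: cst_continuous.
  exact: scalel_continuous.
- by move=> x nx; rewrite (test_function_eq0 tphi nx) mulr0.
Qed.

(** * Sobolev balls *)

Section weak_derivatives.
Context {R : realType} (n b : nat) (F : ('I_n -> nat) -> 'rV[R]_n -> R) (M : R).
Hypothesis cF : forall al, (\sum_i al i <= b)%N -> continuous (F al).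
Hypothesis F_le : forall al, (\sum_i al i <= b)%N -> forall x, `|F al x| <= M.
Hypothesis dF : forall al j, (\sum_i al i < b)%N ->
  line_derive j (F al) (F (fun i => al i + (i == j))%N).

(** [F al] plays the role of the derivative of order [al]. Each step moves the outermost partial
    derivative from the test function to [F]; the size bound keeps all indices within the order [b]
    up to which the family is controlled. *)
Lemma integral_partials (s : seq 'I_n) (al : 'I_n -> nat) (phi : 'rV[R]_n -> R) :
  test_function phi -> (\sum_i al i + size s <= b)%N ->
  \int[lebesgue_rV n]_(x in unit_cube n) (F al x * partials s phi x) =
  (-1) ^+ size s *
  \int[lebesgue_rV n]_(x in unit_cube n) (F (fun i => al i + count_mem i s)%N x * phi x).
Proof.
move=> tphi; elim: s al => [|j s IHs] al /= als.
  rewrite mul1r; apply: eq_Rintegral => x _; congr (F _ _ * _).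
  by apply/funext => i; rewrite addn0.
have sum1 : (\sum_i (al i + (i == j)) = (\sum_i al i).+1)%N.
  rewrite big_split /= -addn1; congr (_ + _)%N.
  by rewrite -big_mkcond /= big_pred1_eq.
rewrite addnS in als.
rewrite (@integration_by_parts_cube _ _ j _ (F (fun i => al i + (i == j))%N) _ M).
- rewrite IHs ?sum1// exprS mulN1r mulNr; congr (- (_ * _)).
  apply: eq_Rintegral => x _; congr (F _ _ * _).
  by apply/funext => i; rewrite -addnA [i == j]eq_sym.
- by apply: cF; rewrite (leq_trans _ als)// leqW// leq_addr.
- by apply: cF; rewrite sum1 (leq_trans _ als)// ltnS leq_addr.
- by apply: dF; rewrite (leq_trans _ als)// ltnS leq_addr.
- by apply: F_le; rewrite (leq_trans _ als)// leqW// leq_addr.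
- by apply: F_le; rewrite sum1 (leq_trans _ als)// ltnS leq_addr.
- exact: test_function_partials.
Qed.

Lemma weak_derivative_family (a : multi_index n b) : order_of a = b ->
  weak_derivative a (F (fun=> 0%N)) (F (fun i => a i)).
Proof.
move=> ab phi tphi.
pose s := flatten [seq nseq (a j) j | j <- enum 'I_n].
have count_s i : count_mem i s = a i.
  rewrite /s count_flatten -map_comp sumnE big_map big_enum /=.
  rewrite (bigD1 i)//= count_nseq /= eqxx mul1n big1 ?addn0// => j ji.
  by rewrite count_nseq /= (negbTE ji).
have size_s : size s = order_of a.
  rewrite /s size_flatten /shape -map_comp sumnE big_map big_enum /=.
  by apply: eq_bigr => i _; rewrite size_nseq.
rewrite /Dmulti -/s integral_partials//; last by rewrite size_s ab sum_nat_const muln0.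
rewrite size_s; congr (_ * _); apply: eq_Rintegral => x _; congr (F _ _ * _).
by apply/funext => i; rewrite add0n count_s.
Qed.

(** The Euclidean norm of the vector of derivatives is at most the number of multi-indices times
    [B], and the cube has measure 1, so this uniform bound also bounds the [L_p] norm, whatever
    [p]. *)
Lemma sobolev_ball_family p (L B : R) : (0 < p)%N -> 0 <= B ->
  (forall al, (\sum_i al i)%N = b -> forall x, `|F al x| <= B) ->
  #|multi_index n b|%:R * B <= L ->
  sobolev_ball b p L (F (fun=> 0%N)).
Proof.
move=> p0 B0 FB BL; split.
  by apply: continuous_subspaceT; apply: cF; rewrite sum_nat_const muln0.
exists (fun a : multi_index n b => F (fun i => a i)); split.
  move=> a ab; split; last exact: weak_derivative_family.
  apply: measurable_funTS; apply: continuous_measurable_rV; apply: cF.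
  by rewrite [leqLHS]ab.
have L0 : 0 <= L by apply: le_trans BL; rewrite mulr_ge0.
have p0' : (0 : R) < p%:R by rewrite ltr0n.
rewrite /Lp_norm_vec.
pose h x := Num.sqrt (\sum_(a : multi_index n b | order_of a == b) F (fun i => a i) x ^+ 2).
have hL x : h x <= L.
  apply: le_trans BL; set m := #|_|%:R.
  have m1 : 1 <= m by rewrite ler1n; apply/card_gt0P; exists [ffun=> ord0].
  rewrite -[leRHS]ger0_norm ?mulr_ge0// ?(le_trans _ m1)// -sqrtr_sqr.
  apply: ler_wsqrtr; rewrite exprMn.
  apply: (@le_trans _ _ (m * B ^+ 2)); last first.
    by apply: ler_wpM2r; rewrite ?sqr_ge0// expr2 ler_peMl// (le_trans _ m1).
  rewrite /m -sum1_card natr_sum mulr_suml big_mkcond /=; apply: ler_sum => a _.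
  case: eqP => ab; last by rewrite mul1r sqr_ge0.
  by rewrite mul1r -real_normK ?num_real// lerXn2r ?nnegrE// FB.
rewrite unlock /=.
apply: (@le_trans _ _ ((L `^ p%:R)%:E `^ p%:R^-1)%E); last first.
  by rewrite poweR_EFin -powRrM mulfV ?gt_eqF// powRr1.
apply: gt0_ler_poweR.
- by rewrite invr_ge0 ltW.
- rewrite in_itv /= leey ?andbT; apply: integral_ge0 => x _; exact: poweR_ge0.
- by rewrite in_itv /= leey ?andbT lee_fin powR_ge0.
rewrite (_ : (\int[_]_x _)%E = (\int[lebesgue_rV n]_(x in unit_cube n) ((h x) `^ p%:R)%:E)%E); last first.
  rewrite [RHS]integral_mkcond; apply: eq_integral => x _.
  rewrite !patchE; case: ifPn => _; last by rewrite abse0 poweR0r// gt_eqF.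
  by rewrite abse_EFin poweR_EFin ger0_norm// sqrtr_ge0.
apply: (@le_trans _ _ (\int[lebesgue_rV n]_(x in unit_cube n) (L `^ p%:R)%:E)%E); last first.
  rewrite (integral_cst (lebesgue_rV n) (@measurable_unit_cube R n) (L `^ p%:R)%:E).
  have -> : (lebesgue_rV n : {measure set _ -> \bar R}) (@unit_cube R n) = 1%E.
    exact: lebesgue_rV_unit_cube.
  by rewrite mule1.
have mh : measurable_fun setT h.
  apply: measurableT_comp; first exact: (continuous_measurable_fun (@sqrt_continuous R)).
  rewrite (_ : (fun x => _) = (fun x => \sum_(a : multi_index n b)
      if order_of a == b then F (fun i => a i) x ^+ 2 else 0)); last first.
    by apply/funext => x; rewrite big_mkcond.
  apply: measurable_sum => a; case: eqP => // ab; apply: measurable_funX.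
  by apply: continuous_measurable_rV; apply: cF; rewrite [leqLHS]ab.
apply: ge0_le_integral => //.
- exact: measurable_unit_cube.
- by move=> x _; rewrite lee_fin powR_ge0.
- apply: measurable_funTS; apply/measurable_EFinP.
  exact: (measurableT_comp (@measurable_powR R p%:R)).
move=> x _; rewrite lee_fin; apply: ge0_ler_powR => //; rewrite ?nnegrE ?(ltW p0')//.
exact: sqrtr_ge0.
Qed.

End weak_derivatives.

(** * Bump functions *)

Lemma continuous_posX (R : realType) k : continuous (fun x : R => Num.max x 0 ^+ k).
Proof.
move=> x; apply: (@continuous_comp _ _ _ (fun x : R => Num.max x 0) (fun y : R => y ^+ k)).
  apply: (@continuous_max R R id (cst 0)); first by move=> y; exact: cvg_id.
  exact: cst_continuous.
exact: exprn_continuous.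
Qed.

(** The exponent is at least 2, so at the kink the difference quotient [max(h, 0)^(k + 1)] still
    tends to 0. *)
Lemma is_derive_posX (R : realType) k (x : R) :
  is_derive x (1 : R) (fun x : R => Num.max x 0 ^+ k.+2)
    (k.+2%:R * Num.max x 0 ^+ k.+1).
Proof.
have [x0|x0|->] := ltgtP x 0.
- apply: (@near_eq_is_derive R R R (cst 0)).
    near=> y; rewrite /= max_r ?expr0n//; near: y.
    exact: lt_le_nbhsl.
  by rewrite expr0n mulr0; exact: is_derive_cst.
- apply: (@near_eq_is_derive R R R (fun y : R => y ^+ k.+2)).
    near=> y; rewrite /= max_l//; near: y; exact: lt_le_nbhsr.
  have := @is_deriveX R R id k.+2 x 1 1 (is_derive_id x 1).
  by rewrite exprfctE /= [_ *: _]mulr1.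
- have cvg0 : (fun h : R => h^-1 *: (((fun x : R => Num.max x 0 ^+ k.+2) \o shift 0) (h *: (1 : R))
      - Num.max 0 0 ^+ k.+2)) @ 0^' --> (0 : R).
    apply: cvg_trans (_ : (fun h : R => Num.max h 0 ^+ k.+1) @ 0^' --> (0:R)).
      apply: near_eq_cvg; near=> h.
      have h0 : h != 0 by near: h; exact: nbhs_dnbhs_neq.
      rewrite /= maxxx expr0n subr0 addr0 [h *: 1]mulr1 [_ *: _]mulrC.
      have [hn|hp] := leP h 0; first by rewrite !expr0n mul0r.
      by rewrite [in RHS]exprSr mulfK.
    have := @continuous_withinNx _ _ (fun h : R => Num.max h 0 ^+ k.+1) 0.
    rewrite maxxx expr0n => -[+ _]; apply; exact: continuous_posX.
  rewrite ?maxxx expr0n mulr0; apply: DeriveDef; first by apply/cvg_ex; exists 0.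
  exact/cvg_lim.
Unshelve. all: by end_near. Qed.

(** Since [max(v, 0)^(k + 2) = v * max(v, 0)^(k + 1)], one power can be moved into the polynomial
    factor: the derivative keeps the same shape with the exponent lowered by one. This is the
    recursion of [bump_poly]. *)
Lemma posX_poly_derive (R : realType) (p v : {poly R}) k (t : R) :
  is_derive t (1 : R) (fun t => p.[t] * Num.max v.[t] 0 ^+ k.+2)
    ((p^`() * v + (k.+2%:R *: (p * v^`()))).[t] * Num.max v.[t] 0 ^+ k.+1).
Proof.
have dp : is_derive t (1 : R) (horner p) p^`().[t] by exact: is_derive_poly.
have dv : is_derive t (1 : R) (horner v) v^`().[t] by exact: is_derive_poly.
have dw := is_derive1_comp (is_derive_posX k v.[t]) dv.
have := @is_deriveM R R (horner p) (fun t => Num.max v.[t] 0 ^+ k.+2) t 1 _ _ dp dw.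
move=> /is_derive_eq; apply.
rewrite !hornerE /= ![_ *: _]mulrC.
have -> : Num.max v.[t] 0 ^+ k.+2 = v.[t] * Num.max v.[t] 0 ^+ k.+1.
  have [vn|vp] := leP v.[t] 0; first by rewrite !expr0n mulr0.
  by rewrite exprS.
ring.
Qed.

(* The factor 4 normalises the maximum of [4 t (1 - t)] to 1. *)
Definition bump_base (R : realType) : {poly R} := 4%:R *: ('X * (1 - 'X)).

Lemma bump_baseE (R : realType) (t : R) : (bump_base R).[t] = 4 * (t * (1 - t)).
Proof. by rewrite !hornerE. Qed.

(* [bump b i] is the i-th derivative of the b-times continuously differentiable
   function [max(4 t (1 - t), 0) ^ (b + 1)]. *)
Fixpoint bump_poly (R : realType) (b i : nat) : {poly R} :=
  if i is k.+1 then
    (bump_poly R b k)^`() * bump_base R +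
      (b.+1 - k)%:R *: (bump_poly R b k * (bump_base R)^`())
  else 1.

Definition bump (R : realType) (b i : nat) (t : R) : R :=
  (bump_poly R b i).[t] * Num.max (bump_base R).[t] 0 ^+ (b.+1 - i).

(** For [i < b] the exponent [b + 1 - i] is at least 2, as differentiation at the kinks requires; at
    [i = b] it is 1, which still gives continuity and vanishing outside the unit interval. *)
Lemma is_derive_bump (R : realType) b i (t : R) : (i < b)%N ->
  is_derive t (1 : R) (@bump R b i) (bump b i.+1 t).
Proof.
move=> ib; have e1 : (b.+1 - i = (b - i.+1).+2)%N by rewrite -!subSn// ltnW.
have e2 : (b.+1 - i.+1 = (b - i.+1).+1)%N by rewrite -subSn.
rewrite /bump [bump_poly R b i.+1]/= e2 e1.
exact: posX_poly_derive.
Qed.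

Lemma continuous_bump (R : realType) b i : continuous (@bump R b i).
Proof.
move=> t; apply: (@continuousM _ _ (horner (bump_poly R b i))).
  exact: continuous_horner.
apply: (@continuous_comp _ _ _ (horner (bump_base R)) (fun y : R => Num.max y 0 ^+ (b.+1 - i))).
  exact: continuous_horner.
exact: continuous_posX.
Qed.

Lemma bump_eq0 (R : realType) b i (t : R) : (i <= b)%N -> ~~ (0 < t < 1) -> bump b i t = 0.
Proof.
move=> ib nt; rewrite /bump max_r; first by rewrite subSn// expr0n mulr0.
rewrite bump_baseE pmulr_rle0//.
move: nt; rewrite negb_and -!leNgt => /orP[t0|t1].
  by apply: mulr_le0_ge0 => //; lra.
by apply: mulr_ge0_le0; lra.
Qed.

Lemma bump0_ge0 (R : realType) b (t : R) : 0 <= bump b 0 t.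
Proof. by rewrite /bump /= hornerC mul1r exprn_ge0// le_max lexx orbT. Qed.

Lemma bump0_le1 (R : realType) b (t : R) : bump b 0 t <= 1.
Proof.
rewrite /bump /= hornerC mul1r exprn_ile1//; first by rewrite le_max lexx orbT.
by rewrite ge_max ler01 andbT bump_baseE; have := sqr_ge0 (2 * t - 1); rewrite expr2; lra.
Qed.

Lemma bump0_ge (R : realType) b (t : R) : 1 / 4 <= t <= 3 / 4 ->
  (3 / 4) ^+ b.+1 <= bump b 0 t.
Proof.
move=> /andP[t1 t2]; rewrite /bump /= hornerC mul1r.
apply: lerXn2r; rewrite ?nnegrE ?le_max ?lexx ?orbT//.
rewrite bump_baseE; apply/orP; left.
have : 0 <= (t - 1 / 4) * (3 / 4 - t) by rewrite mulr_ge0// subr_ge0.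
lra.
Qed.

Lemma bump_bounded (R : realType) b :
  exists B : R, 1 <= B /\ forall i t, (i <= b)%N -> `|bump b i t| <= B.
Proof.
have bounded1 i : exists M : R, 0 <= M /\ ((i <= b)%N -> forall t, `|bump b i t| <= M).
  have /compact_bounded[M [_ HM]] : compact (@bump R b i @` `[0, 1]%classic).
    apply: continuous_compact; last exact: segment_compact.
    exact/continuous_subspaceT/continuous_bump.
  exists (`|M| + 1); split=> [|ib t]; first by rewrite addr_ge0.
  have [t01|t01] := boolP (0 < t < 1); last by rewrite bump_eq0// normr0 addr_ge0.
  apply: HM; first by rewrite (le_lt_trans (ler_norm M))// ltrDl.
  by exists t => //; rewrite /= in_itv /=; case/andP: t01 => /ltW-> /ltW->.
have [M HM] := choice bounded1.
exists (1 + \sum_(i < b.+1) M i); split.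
  by rewrite lerDl sumr_ge0// => i _; have [] := HM i.
move=> i t ib; have [_ /(_ ib t) /le_trans] := HM i; apply.
have ib' : (i < b.+1)%N by [].
rewrite (bigD1 (Ordinal ib'))//= addrCA lerDl addr_ge0// sumr_ge0// => k _.
by have [] := HM k.
Qed.

Lemma is_derive_fin_sum (R : realType) (I : finType) (h : I -> R -> R) (dh : I -> R) (x : R) :
  (forall i, is_derive x (1 : R) (h i) (dh i)) ->
  is_derive x (1 : R) (fun t => \sum_i h i t) (\sum_i dh i).
Proof.
move=> hd; rewrite (_ : (fun t => _) = \sum_i h i); last first.
  by apply/funext => t; rewrite fct_sumE.
by elim/big_ind2 : _ => // [|f df g dg ? ?]; [exact: is_derive_cst|exact: is_deriveD].
Qed.

Lemma continuous_fin_sum (R : realType) (T : topologicalType) (I : finType) (f : I -> T -> R) :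
  (forall i, continuous (f i)) -> continuous (fun x => \sum_i f i x).
Proof.
move=> cf; elim: (index_enum I) => [|i r IHr].
  by under eq_fun do rewrite big_nil; exact: cst_continuous.
under eq_fun do rewrite big_cons.
by move=> x; apply: (@continuousD _ _ _ (f i)); [exact: cf|exact: IHr].
Qed.

Lemma continuous_fin_prod (R : realType) (T : topologicalType) (I : finType) (f : I -> T -> R) :
  (forall i, continuous (f i)) -> continuous (fun x => \prod_i f i x).
Proof.
move=> cf; elim: (index_enum I) => [|i r IHr].
  by under eq_fun do rewrite big_nil; exact: cst_continuous.
under eq_fun do rewrite big_cons.
by move=> x; apply: (@continuousM _ _ (f i)); [exact: cf|exact: IHr].
Qed.

Section bump_wave.
Context {R : realType} (n b K : nat) (A : R).

Definition bump_cell := {ffun 'I_n -> 'I_K}.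

Definition bump_prod (al : 'I_n -> nat) (k : bump_cell) (x : 'rV[R]_n) : R :=
  \prod_j bump b (al j) (K%:R * x ord0 j - (k j)%:R).

(** With [al] zero, the function that encodes [w]; for other [al] of order at most [b], its partial
    derivative, the power of [K] coming from the chain rule. *)
Definition bump_wave (w : {ffun bump_cell -> bool}) (al : 'I_n -> nat) (x : 'rV[R]_n) : R :=
  A * K%:R ^+ (\sum_j al j) * \sum_k (w k)%:R * bump_prod al k x.

Lemma continuous_bump_prod al (k : bump_cell) : continuous (bump_prod al k).
Proof.
apply: continuous_fin_prod => j x.
apply: (@continuous_comp _ _ _ (fun x : 'rV[R]_n => K%:R * x ord0 j - (k j)%:R) (bump b (al j))).
  apply: (@continuousB _ _ _ (fun x : 'rV[R]_n => K%:R * x ord0 j)); last exact: cst_continuous.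
  by apply: (@continuousM _ _ (cst K%:R)); [exact: cst_continuous|exact: coord_continuous].
exact: continuous_bump.
Qed.

Lemma continuous_bump_wave w al : continuous (bump_wave w al).
Proof.
move=> x; apply: (@continuousM _ _ (cst _)); first exact: cst_continuous.
apply: continuous_fin_sum => k y.
apply: (@continuousM _ _ (cst _)); first exact: cst_continuous.
exact: continuous_bump_prod.
Qed.

Lemma line_derive_bump_wave w al j : (\sum_i al i < b)%N ->
  line_derive j (bump_wave w al) (bump_wave w (fun i => al i + (i == j))%N).
Proof.
move=> alb x t.
have alj : (al j < b)%N by rewrite (leq_ltn_trans _ alb)// (bigD1 j)//= leq_addr.
have sum1 : (\sum_i (al i + (i == j)) = (\sum_i al i).+1)%N.
  rewrite big_split /= -addn1; congr (_ + _)%N.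
  by rewrite -big_mkcond /= big_pred1_eq.
have coordE (s : R) i : (x + s *: 'e_j) ord0 i = x ord0 i + s * (i == j)%:R.
  by rewrite !mxE eqxx.
have dprod (k : bump_cell) : is_derive t (1 : R)
    (fun s : R => (w k)%:R * bump_prod al k (x + s *: 'e_j))
    (K%:R * ((w k)%:R * bump_prod (fun i => al i + (i == j))%N k (x + t *: 'e_j))).
  pose c := (w k)%:R * \prod_(i | i != j) bump b (al i) (K%:R * x ord0 i - (k i)%:R).
  have rest be (s : R) : (forall i, i != j -> be i = al i) ->
      \prod_(i | i != j) bump b (be i) (K%:R * (x + s *: 'e_j) ord0 i - (k i)%:R) =
      \prod_(i | i != j) bump b (al i) (K%:R * x ord0 i - (k i)%:R).
    move=> beal; apply: eq_bigr => i ij.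
    by rewrite beal// coordE (negbTE ij) mulr0 addr0.
  rewrite (_ : (fun s => _) = (fun s : R => c * bump b (al j) (K%:R * (x ord0 j + s) - (k j)%:R))); last first.
    apply/funext => s; rewrite /bump_prod (bigD1 j)//= rest// coordE eqxx mulr1 /c.
    by ring.
  have dlin : is_derive t (1 : R) (fun s : R => K%:R * (x ord0 j + s) - (k j)%:R) K%:R.
    have := @is_deriveZ R R R id (K%:R) t 1 _ (is_derive_id t 1).
    rewrite (_ : (fun s : R => _) = (K%:R \*: id) + cst (K%:R * x ord0 j - (k j)%:R)); last first.
      apply/funext => s; rewrite [RHS](_ : _ = K%:R * s + (K%:R * x ord0 j - (k j)%:R))//.
      by ring.
    move=> dK; have := is_deriveD dK (is_derive_cst (K%:R * x ord0 j - (k j)%:R) t 1).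
    by move=> /is_derive_eq; apply; rewrite addr0 [_ *: _]mulr1.
  have dbump := @is_derive1_comp R (bump b (al j))
    (fun s : R => K%:R * (x ord0 j + s) - (k j)%:R) t _ _
    (is_derive_bump (K%:R * (x ord0 j + t) - (k j)%:R) alj) dlin.
  have := @is_deriveZ R R R _ c t 1 _ dbump.
  move=> /is_derive_eq; apply.
  rewrite /bump_prod (bigD1 j)//= rest => [|i /negbTE ->]; last by rewrite addn0.
  rewrite eqxx addn1 coordE eqxx mulr1 /c /=.
  rewrite [_ *: _]mulrC; ring.
have := @is_deriveZ R R R _ (A * K%:R ^+ (\sum_j al j)) t 1 _ (is_derive_fin_sum dprod).
move=> /is_derive_eq; apply.
by rewrite /bump_wave sum1 exprSr -mulr_sumr [_ *: _]mulrA mulrA.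
Qed.

End bump_wave.

Lemma bump_shift_eq0 (R : realType) b i K (t : R) (c c' : 'I_K) : (i <= b)%N ->
  c' != c -> 0 < t - c%:R < 1 -> bump b i (t - c'%:R) = 0.
Proof.
move=> ib cc' /andP[t0 t1]; apply: bump_eq0 => //; apply: contra cc' => /andP[t0' t1'].
have h1 : (c'%:R : R) < c.+1%:R by rewrite -natr1; lra.
have h2 : (c%:R : R) < c'.+1%:R by rewrite -natr1; lra.
move: h1 h2; rewrite !ltr_nat !ltnS => h1 h2.
by apply/eqP/val_inj/eqP; rewrite eqn_leq h1 h2.
Qed.

(** Translates by distinct integers are nonzero on disjoint intervals, so at most one term survives
    and the bound does not grow with [K]. *)
Lemma sum_bump_shift (R : realType) b i K (B t : R) : (i <= b)%N ->
  (forall t, `|bump b i t| <= B) -> \sum_(c < K) `|bump b i (t - c%:R)| <= B.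
Proof.
move=> ib bB.
have B0 : 0 <= B by apply: le_trans (bB 0); exact: normr_ge0.
have [[c ct]|nc] := pselect (exists c : 'I_K, 0 < t - c%:R < 1).
  rewrite (bigD1 c)//= big1 ?addr0// => c' cc'.
  by rewrite (bump_shift_eq0 ib cc' ct) normr0.
rewrite big1// => c _; rewrite bump_eq0 ?normr0//.
by apply/negP => ct; apply: nc; exists c.
Qed.

Lemma card_ord_range N a m : (\sum_(c < N) (a <= c < a + m)%N <= m)%N.
Proof.
set S := [pred c : 'I_N | (a <= c < a + m)%N].
rewrite (_ : (\sum_(c < N) _)%N = #|S|); last first.
  by rewrite -sum1_card [RHS]big_mkcond; apply: eq_bigr => c _; rewrite inE; case: ifP.
rewrite cardE -(size_map val) -[leqRHS](size_iota a); apply: uniq_leq_size.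
  by rewrite map_inj_uniq ?enum_uniq//; exact: val_inj.
by move=> _ /mapP[c + ->]; rewrite mem_enum inE mem_iota.
Qed.

(** Each term is at most 1 and is nonzero only for [c + 1] in an open interval of length [N / K],
    which contains at most [N %/ K + 1] integers; this is at most [2 N / K] since [K <= N]. *)
Lemma sum_bump_design (R : realType) b K N (k : 'I_K) : (K <= N)%N ->
  \sum_(c < N) bump b 0 (K%:R * (c.+1%:R / N%:R) - k%:R) ^+ 2 <= 2 * (N%:R / K%:R) :> R.
Proof.
move=> KN; have K0 : (0 < K)%N by apply: leq_ltn_trans (ltn_ord k).
have N0 : (0 < N)%N by exact: leq_trans KN.
have Kr0 : 0 < K%:R :> R by rewrite ltr0n.
have Nr0 : 0 < N%:R :> R by rewrite ltr0n.
pose a := (k * N %/ K)%N; pose m := (N %/ K).+1.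
have mK : m%:R <= 2 * (N%:R / K%:R) :> R.
  rewrite mulrA ler_pdivlMr// -!natrM ler_nat /m mulSn mul2n -addnn.
  by rewrite leq_add// leq_trunc_div.
apply: le_trans mK; apply: (@le_trans _ _ (\sum_(c < N) (a <= c < a + m)%N)%:R); last first.
  by rewrite ler_nat card_ord_range.
rewrite natr_sum; apply: ler_sum => c _.
have [|nc] := boolP (a <= c < a + m)%N.
  by rewrite expr_le1 ?bump0_ge0 ?bump0_le1.
rewrite bump_eq0 ?expr0n//; apply: contra nc => /andP[].
rewrite subr_gt0 ltrBlDr mulrA -natrM nat1r.
rewrite ltr_pdivlMr// ltr_pdivrMr// -!natrM !ltr_nat => h1 h2.
apply/andP; split.
  by rewrite -ltnS ltn_divLR// [ltnRHS]mulnC.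
rewrite /m addnS ltnS.
have e1 := divn_eq (k * N) K; have e2 := divn_eq N K.
have r1 := ltn_pmod (k * N) K0; have r2 := ltn_pmod N K0.
rewrite -/a in e1.
(* The remainders of the two divisions by [K] are each below [K], whence the 2. *)
have : (K * c.+1 < K * (a + N %/ K + 2))%N.
  move: e1 e2 r1 r2 h2; rewrite !mulnDr mulSn; set q := (N %/ K)%N; nia.
by rewrite ltn_pmul2l//; lia.
Qed.

(** With as many cells as grid steps the argument is the integer [c + 1 - k], never strictly between
    0 and 1. *)
Lemma bump_design_eq0 (R : realType) b N (k c : 'I_N) :
  bump b 0 (N%:R * (c.+1%:R / N%:R) - k%:R) = 0 :> R.
Proof.
have N0 : (0 < N)%N by apply: leq_ltn_trans (ltn_ord k).
rewrite bump_eq0// mulrCA mulfV ?pnatr_eq0 -?lt0n// mulr1.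
by apply/negP; rewrite subr_gt0 ltrBlDl natr1 !ltr_nat => /andP[]; lia.
Qed.

Section bump_wave_bounds.
Context {R : realType} (n b K : nat) (A B : R).
Hypothesis K_gt0 : (0 < K)%N.
Hypothesis A_ge0 : 0 <= A.
Hypothesis bump_le : forall i t, (i <= b)%N -> `|bump b i t| <= B.

Local Notation cell := (bump_cell n K).

(** The sum over cells of products over coordinates is a product over coordinates of sums over
    translates, each at most [B]. *)
Lemma bump_wave_bounded (w : {ffun cell -> bool}) (al : 'I_n -> nat) x :
  (\sum_i al i <= b)%N ->
  `|bump_wave b A w al x| <= A * K%:R ^+ (\sum_i al i) * B ^+ n.
Proof.
move=> alb; have alj j : (al j <= b)%N.
  by rewrite (leq_trans _ alb)// (bigD1 j)//= leq_addr.
rewrite /bump_wave normrM ger0_norm; last by rewrite mulr_ge0// exprn_ge0.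
apply: ler_wpM2l; first by rewrite mulr_ge0// exprn_ge0.
apply: le_trans (ler_norm_sum _ _ _) _.
apply: (@le_trans _ _ (\sum_(k : cell) \prod_j
    `|bump b (al j) (K%:R * x ord0 j - (k j)%:R)|)).
  apply: ler_sum => k _; rewrite normrM /bump_prod normr_prod.
  by rewrite ler_piMl ?prodr_ge0//; case: (w k); rewrite ?normr1 ?normr0.
rewrite -(bigA_distr_bigA (fun j (c : 'I_K) => `|bump b (al j) (K%:R * x ord0 j - c%:R)|)).
rewrite -[leRHS](_ : \prod_(j < n) B = _); last by rewrite prodr_const card_ord.
apply: ler_prod => j _; rewrite sumr_ge0//=.
by apply: sum_bump_shift => // t; exact: bump_le.
Qed.

Lemma bump_wave_sobolev_ball (w : {ffun cell -> bool}) p (L : R) : (0 < p)%N -> 1 <= B ->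
  #|multi_index n b|%:R * (A * K%:R ^+ b * B ^+ n) <= L ->
  sobolev_ball b p L (bump_wave b A w (fun=> 0%N)).
Proof.
move=> p0 B1; have B0 : 0 <= B ^+ n by rewrite exprn_ge0// (le_trans ler01).
have K1 : 1 <= K%:R :> R by rewrite ler1n.
apply: (sobolev_ball_family (F := bump_wave b A w) (M := A * K%:R ^+ b * B ^+ n)) => //.
- by move=> al _; exact: continuous_bump_wave.
- move=> al alb x; apply: le_trans (bump_wave_bounded _ _ alb) _.
  by rewrite ler_wpM2r// ler_wpM2l// ler_weXn2l.
- by move=> al j alb; exact: line_derive_bump_wave.
- by rewrite !mulr_ge0// exprn_ge0.
- by move=> al alb x; have := bump_wave_bounded w x (eq_leq alb); rewrite alb.
Qed.

(** The concentric cube of half the side of cell [k]: there its bump stays above a positive constant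
    and all other bumps vanish, so the loss is measured on these sets only. *)
Definition inner_cell (k : cell) : set 'rV[R]_n :=
  [set x | forall j, 1 / 4 <= K%:R * x ord0 j - (k j)%:R <= 3 / 4].

Let Kr_gt0 : 0 < K%:R :> R. Proof. by rewrite ltr0n. Qed.

Let inner_itv (k : cell) j : set R :=
  `[((k j)%:R + 1 / 4) / K%:R, ((k j)%:R + 3 / 4) / K%:R]%classic.

Lemma inner_cellE (k : cell) :
  inner_cell k = [set x | forall j, inner_itv k j (x ord0 j)].
Proof.
apply/seteqP; split => x /= kx j; have := kx j; rewrite /inner_itv /= in_itv /=
  (ler_pdivrMr _ _ Kr_gt0) (ler_pdivlMr _ _ Kr_gt0) => /andP[? ?]; apply/andP; split; lra.
Qed.

Lemma measurable_inner_cell (k : cell) : measurable (inner_cell k).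
Proof.
rewrite inner_cellE [X in measurable X](_ : _ = \bigcap_(j in [set: 'I_n])
    ((fun x : 'rV[R]_n => x ord0 j) @^-1` inner_itv k j)); last first.
  by apply/seteqP; split => x /= bx j; have := bx j; [|exact].
apply: fin_bigcap_measurable => // j _; rewrite -[X in measurable X]setTI.
by apply: (@measurable_coord _ R 1 n ord0 j) => //; exact: measurable_itv.
Qed.

Lemma lebesgue_rV_inner_cell (k : cell) :
  lebesgue_rV n (inner_cell k) = ((2 * K%:R)^-1 ^+ n)%:E.
Proof.
have itvE j : lebesgue_measure (inner_itv k j) = ((2 * K%:R)^-1)%:E.
  rewrite /inner_itv lebesgue_measure_itv /= lte_fin ltr_pM2r ?invr_gt0//.
  have -> : (k j)%:R + 1 / 4 < (k j)%:R + 3 / 4 :> R by rewrite ltrD2l; lra.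
  by rewrite -EFinB; congr EFin; field; rewrite gt_eqF.
rewrite inner_cellE /lebesgue_rV (@product_measure_rV_box R n _ (inner_itv k)); last first.
  by move=> j; exact: measurable_itv.
rewrite -[n in RHS]card_ord -prodr_const -prodEFin; apply: eq_bigr => j _.
exact: itvE.
Qed.

Lemma inner_cell_sub (k : cell) : inner_cell k `<=` unit_cube n.
Proof.
move=> x kx j; have /andP[k1 k2] := kx j.
have kj : (k j).+1%:R <= K%:R :> R by rewrite ler_nat.
have kj0 : 0 <= (k j)%:R :> R by [].
rewrite -natr1 in kj; apply/andP; split.
  by rewrite -(pmulr_rge0 _ Kr_gt0); lra.
by rewrite -(ler_pM2l Kr_gt0); lra.
Qed.

Lemma bump_prod_inner_ge (k : cell) x : inner_cell k x ->
  ((3 / 4) ^+ b.+1) ^+ n <= bump_prod b (fun=> 0%N) k x.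
Proof.
move=> kx; rewrite -[leLHS](_ : \prod_(j < n) ((3 / 4) ^+ b.+1) = _); last first.
  by rewrite prodr_const card_ord.
by apply: ler_prod => j _; rewrite exprn_ge0//= bump0_ge.
Qed.

Lemma bump_prod_inner_eq0 (k k' : cell) x : k' != k -> inner_cell k x ->
  bump_prod b (fun=> 0%N) k' x = 0.
Proof.
move=> kk' kx; have [j kj] : exists j, k' j != k j.
  apply/existsP; apply: contraNT kk'; rewrite negb_exists => /forallP kk'.
  by apply/eqP/ffunP => j; apply/eqP; have := kk' j; rewrite negbK.
rewrite /bump_prod (bigD1 j)//= (bump_shift_eq0 _ kj) ?mul0r//.
by have /andP[? ?] := kx j; apply/andP; split; lra.
Qed.

(** At a common point of two distinct inner cells the same bump would be both positive and zero. *)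
Lemma trivIset_inner_cell (k k' : cell) x : inner_cell k x -> inner_cell k' x -> k = k'.
Proof.
move=> kx kx'; apply/eqP; apply: contraT => kk'.
have := bump_prod_inner_ge kx; rewrite (bump_prod_inner_eq0 kk' kx') leNgt.
by rewrite !exprn_gt0.
Qed.

Lemma bump_wave_inner (w : {ffun cell -> bool}) (k : cell) x : inner_cell k x ->
  bump_wave b A w (fun=> 0%N) x = A * ((w k)%:R * bump_prod b (fun=> 0%N) k x).
Proof.
move=> kx; rewrite /bump_wave sum_nat_const muln0 expr0 mulr1 (bigD1 k)//= big1 ?addr0//.
by move=> k' kk'; rewrite (bump_prod_inner_eq0 kk' kx) mulr0.
Qed.

Lemma bump_wave_flip (w : {ffun cell -> bool}) (k : cell) x :
  (bump_wave b A w (fun=> 0%N) x - bump_wave b A (flip k w) (fun=> 0%N) x) ^+ 2 =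
  A ^+ 2 * bump_prod b (fun=> 0%N) k x ^+ 2.
Proof.
rewrite /bump_wave sum_nat_const muln0 expr0 mulr1 -mulrBr -sumrB (bigD1 k)//= big1.
  by rewrite addr0 ffunE eqxx /= !exprMn; case: (w k) => /=; ring.
by move=> k' /negbTE kk'; rewrite ffunE kk' /= subrr.
Qed.

(** Over the grid the sum factorises over the coordinates; for [K = N] one vanishing factor
    suffices, and [0 < n] provides it. *)
Lemma sum_bump_prod_design N (k : cell) : (0 < n)%N -> (K <= N)%N ->
  \sum_(i : {ffun 'I_n -> 'I_N}) bump_prod b (fun=> 0%N) k (design_point i) ^+ 2 <=
  if (K < N)%N then (2 * (N%:R / K%:R)) ^+ n else 0 :> R.
Proof.
move=> n0 KN.
rewrite (eq_bigr (fun i : {ffun 'I_n -> 'I_N} => \prod_j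
    bump b 0 (K%:R * ((i j).+1%:R / N%:R) - (k j)%:R) ^+ 2)); last first.
  by move=> i _; rewrite /bump_prod -prodrXl; apply: eq_bigr => j _; rewrite mxE.
rewrite -(bigA_distr_bigA (fun j (c : 'I_N) =>
    bump b 0 (K%:R * (c.+1%:R / N%:R) - (k j)%:R) ^+ 2)).
case: ifPn => [_|]; last first.
  rewrite -leqNgt => NK; have {NK}KN' : K = N by apply/eqP; rewrite eqn_leq KN.
  rewrite (bigD1 (Ordinal n0))//= big1 ?mul0r// => c _; clear KN.
  by move: k; rewrite KN' => k; rewrite bump_design_eq0 expr0n.
rewrite -[n in X in _ <= X]card_ord -prodr_const.
by apply: ler_prod => j _; rewrite sum_bump_design// andbT sumr_ge0// => c _; rewrite sqr_ge0.
Qed.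

End bump_wave_bounds.

(** * Lower bounds on the risk *)

Lemma measurable_cell_loss (R : realType) d N (fhat : observations d N -> 'rV[R]_d -> R)
    (V : set 'rV[R]_d) (g : 'rV[R]_d -> R) :
  estimator d N fhat -> measurable V -> V `<=` unit_cube d -> measurable_fun setT g ->
  measurable_fun setT
    (fun y => \int[lebesgue_rV d]_(x in V) (`|fhat y x - g x| ^+ 2)%:E)%E.
Proof.
move=> mfhat mV Vcube mg.
pose H (yx : observations d N * 'rV[R]_d) : \bar R := (`|fhat yx.1 yx.2 - g yx.2| ^+ 2)%:E.
have mH : measurable_fun (setT `*` V) H.
  apply/measurable_EFinP; apply: measurable_funX; apply: measurableT_comp => //.
  apply: measurable_funB.
    apply: measurable_funS mfhat; last by move=> yx [? ?]; split => //; exact: Vcube.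
    by apply: measurableX => //; exact: measurable_unit_cube.
  apply: measurable_funTS; exact: (measurableT_comp mg).
have mHV : measurable_fun setT (H \_ (setT `*` V)).
  by apply/(measurable_restrictT _ _).1 => //; exact: measurableX.
have HV0 z : (0 <= (H \_ (setT `*` V)) z)%E.
  by apply: erestrict_ge0 => // ? _; rewrite lee_fin.
have := measurable_fun_fubini_tonelli_F (m2 := lebesgue_rV d) _ mHV HV0.
congr measurable_fun; apply/funext => y; rewrite /fubini_F [RHS]integral_mkcond.
apply: eq_integral => x _; rewrite !patchE; congr (if _ then _ else _).
by apply/idP/idP => /set_mem xV; apply/mem_set; [have [] := xV|split].
Qed.

Lemma product_measure_rV_setT (R : realType) n
    (m : 'I_n -> {sigma_finite_measure set (measurableTypeR R) -> \bar R}) :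
  (forall i, m i setT = 1%E) -> product_measure_rV m setT = 1%E.
Proof.
move=> m1; transitivity (product_measure_rV m [set v : 'rV[R]_n |
    forall i, [set: measurableTypeR R] (v ord0 i)]).
  by congr (product_measure_rV _ _); apply/seteqP; split.
by rewrite (@product_measure_rV_box R n m (fun=> setT))// big1.
Qed.

Section hypercube.
Context {R : realType} (d N : nat) (eps : R) (heps : 0 < eps < 1) (I : finType).
Variable f : {ffun I -> bool} -> 'rV[R]_d -> R.
Variable Q : {ffun I -> bool} -> {ffun 'I_d -> 'I_N} -> probability (measurableTypeR R) R.
Variables (V : I -> set 'rV[R]_d) (e : I -> 'rV[R]_d -> R) (e0 v : R).
Hypothesis mf : forall w, measurable_fun setT (f w).
Hypothesis me : forall k, measurable_fun setT (e k).
Hypothesis mV : forall k, measurable (V k).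
Hypothesis V_cube : forall k, V k `<=` unit_cube d.
Hypothesis V_disj : forall k k' x, V k x -> V k' x -> k = k'.
Hypothesis V_vol : forall k, lebesgue_rV d (V k) = v%:E.
Hypothesis e0_gt0 : 0 < e0.
Hypothesis v_gt0 : 0 < v.
Hypothesis e_ge : forall k x, V k x -> e0 <= e k x.
Hypothesis fe : forall w k x, V k x -> f w x = (w k)%:R * e k x.
Hypothesis I_gt0 : (0 < #|I|)%N.
Hypothesis law_flip : forall w k A, measurable A ->
  (huber_law heps (f w) (Q w) A * huber_law heps (f w) (Q w) A <=
   (3 / 2)%:E * huber_law heps (f (flip k w)) (Q (flip k w)) A)%E.

(** Assouad's lemma with the loss on [V k] as cell loss. An estimate cannot be close to both 0 and
    [e k] on [V k], which gives the separation with [sigma = e0^2 * v]; as the [V k] are disjoint,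
    the cell losses add up to at most the total loss. *)
Lemma hypercube_lower_bound (fhat : observations d N -> 'rV[R]_d -> R) :
  estimator d N fhat ->
  exists w, ((4%:R^-1)%:E <= huber_law heps (f w) (Q w)
    [set y | ((#|I|%:R * (e0 ^+ 2 * v) / 64)%:E <=
       sq_L2_norm (fun x => fhat y x - f w x)%R)%E])%E.
Proof.
move=> mfhat.
pose loss (w : {ffun I -> bool}) (y : observations d N) : \bar R :=
  sq_L2_norm (fun x => fhat y x - f w x).
pose cell_loss k (b : bool) (y : observations d N) : \bar R :=
  (\int[lebesgue_rV d]_(x in V k) (`|fhat y x - b%:R * e k x| ^+ 2)%:E)%E.
have mbe k (b : bool) : measurable_fun setT (fun x => b%:R * e k x).
  by apply: measurable_funM.
have mfix (g : 'rV[R]_d -> R) (W : set 'rV[R]_d) y : measurable W -> W `<=` unit_cube d ->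
    measurable_fun setT g -> measurable_fun W (fun x => (`|fhat y x - g x| ^+ 2)%:E : \bar R).
  move=> mW Wc mg; apply/measurable_EFinP; apply: measurable_funX; apply: measurableT_comp => //.
  apply: measurable_funB; last exact: measurable_funTS.
  have mpair : measurable_fun W (fun x : 'rV[R]_d => (y, x)).
    by apply: measurable_funTS; exact: pair1_measurable.
  apply: (measurable_comp (F := setT `*` unit_cube d) _ _ mfhat mpair).
    by apply: measurableX => //; exact: measurable_unit_cube.
  by move=> _ [x Wx <-]; split => //; exact: Wc.
have := @assouad R _ (observations d N) I (fun w => huber_law heps (f w) (Q w))
  loss cell_loss (e0 ^+ 2 * v).
have -> : (4%:R^-1)%:E = (1 / 4)%:E :> \bar R by rewrite div1r.
apply => //.
- move=> w; apply: product_measure_rV_setT => k; exact: probability_setT.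
- move=> w; apply: measurable_cell_loss => //; exact: measurable_unit_cube.
- by move=> k b; apply: measurable_cell_loss.
- by move=> k b y; apply: integral_ge0 => x _; rewrite lee_fin.
- move=> w y; rewrite /cell_loss /loss /sq_L2_norm.
  rewrite (eq_bigr (fun k => \int[lebesgue_rV d]_(x in V k) (`|fhat y x - f w x| ^+ 2)%:E)%E); last first.
    by move=> k _; apply: eq_integral => x /set_mem kx; rewrite (fe w kx).
  rewrite -ge0_integral_bigsetU//; last 3 first.
  - exact: index_enum_uniq.
  - by move=> k k' _ _ [x [kx kx']]; exact: V_disj kx kx'.
  - apply: mfix => //; first exact: bigsetU_measurable.
    by move=> x; rewrite -bigcup_seq => -[k _ kx]; exact: V_cube kx.
  apply: ge0_subset_integral => //.
  - exact: bigsetU_measurable.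
  - exact: measurable_unit_cube.
  - by apply: mfix => //; exact: measurable_unit_cube.
  - by move=> x; rewrite -bigcup_seq => -[k _ kx]; exact: V_cube kx.
- by rewrite mulr_gt0// exprn_gt0.
- move=> k y; rewrite /cell_loss -ge0_integralD//; last 2 first.
  - exact: mfix.
  - exact: mfix.
  have -> : (e0 ^+ 2 * v / 2)%:E = (\int[lebesgue_rV d]_(x in V k) (e0 ^+ 2 / 2)%:E)%E.
    rewrite (integral_cst (lebesgue_rV d) (mV k) (e0 ^+ 2 / 2)%:E).
    have -> : (lebesgue_rV d : {measure set _ -> \bar R}) (V k) = v%:E by exact: V_vol.
    by rewrite -EFinM; congr EFin; rewrite mulrAC.
  apply: ge0_le_integral => //.
  - by move=> x _; rewrite lee_fin divr_ge0// sqr_ge0.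
  - by apply: emeasurable_funD; exact: mfix.
  move=> x kx; rewrite -EFinD lee_fin !real_normK ?num_real// mul0r mul1r subr0.
  have ex := e_ge kx.
  have : e0 ^+ 2 <= e k x ^+ 2 by rewrite lerXn2r ?nnegrE ?(ltW e0_gt0)// (le_trans _ ex)// ltW.
  (* [t^2 + (t - e)^2 = e^2 / 2 + (2 t - e)^2 / 2]. *)
  have := sqr_ge0 (2 * fhat y x - e k x); nra.
Qed.

End hypercube.

Section risk.
Context {R : realType} (d N : nat) (eps : R) (heps : 0 < eps < 1).
Local Notation index := {ffun 'I_d -> 'I_N}.

Definition clean_noise (f : 'rV[R]_d -> R) (i : index) : probability (measurableTypeR R) R :=
  normal_prob (f (design_point i)) 1.

(** The constants of the coordinates multiply to the exponential of the sum of squares, at most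
    [exp(1/4) <= 4/3], below the 3/2 that Assouad's argument tolerates. *)
Lemma huber_law_clean_dominated (f g : 'rV[R]_d -> R) (A : set (observations d N)) :
  \sum_(i : index) (f (design_point i) - g (design_point i)) ^+ 2 <= 1 / 4 ->
  measurable A ->
  (huber_law heps f (clean_noise f) A * huber_law heps f (clean_noise f) A <=
   (3 / 2)%:E * huber_law heps g (clean_noise g) A)%E.
Proof.
move=> fg mA.
pose k (j : 'I_#|{: index}|) : R :=
  expR ((f (design_point (enum_val j)) - g (design_point (enum_val j))) ^+ 2).
have dom : chi2_dominated (\prod_j k j) 
    (huber_law heps f (clean_noise f)) (huber_law heps g (clean_noise g)).
  apply: chi2_dominated_product => [j|j]; first exact: expR_ge0.
  apply: (@eq_chi2_dominated _ _ _ _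
    (normal_prob (f (design_point (enum_val j))) 1)
    (normal_prob (g (design_point (enum_val j))) 1)) => [B _|B _|].
  - exact/esym/huber_mixture_normal.
  - exact/esym/huber_mixture_normal.
  - exact: chi2_dominated_normal.
apply: le_trans (chi2_dominated_set mA dom) _.
apply: lee_wpmul2r => //; rewrite lee_fin -expR_sum.
rewrite (_ : \sum_(j < _) _ = \sum_(i : index) (f (design_point i) - g (design_point i)) ^+ 2); last first.
  rewrite [RHS](reindex (fun j : 'I_#|{: index}| => enum_val j))//=.
  by exists enum_rank => i _; [exact: enum_valK|exact: enum_rankK].
apply: (@le_trans _ _ (expR (1 / 4))); first by rewrite ler_expR.
have e0 : 0 < expR (1 / 4) :> R by exact: expR_gt0.
have : (1 + - (1 / 4)) * expR (1 / 4) <= 1 :> R.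
  by rewrite -ler_pdivlMr// [leRHS]div1r -expRN; exact: expR_ge1Dx.
lra.
Qed.

Lemma sobolev_ball_cst b p (L c : R) : (0 < b)%N -> (0 < p)%N -> 0 <= L ->
  sobolev_ball b p L (cst c : 'rV[R]_d -> R).
Proof.
move=> b0 p0 L0.
pose F (al : 'I_d -> nat) : 'rV[R]_d -> R := cst (if (\sum_i al i)%N == 0%N then c else 0).
have -> : (cst c : 'rV[R]_d -> R) = F (fun=> 0%N).
  by rewrite /F sum_nat_const muln0.
apply: (@sobolev_ball_family _ _ _ F `|c| _ _ _ p L 0) => //.
- by move=> al _; exact: cst_continuous.
- by move=> al _ x; rewrite /F /=; case: ifP => // _; rewrite normr0.
- move=> al j _ x t; rewrite /F /=.
  have -> : ((\sum_i (al i + (i == j)))%N == 0)%N = false.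
    by apply/negbTE; rewrite -lt0n (bigD1 j)//= eqxx addn1.
  exact: is_derive_cst.
- by move=> al alb x; rewrite /F alb gtn_eqF// normr0.
- by rewrite mulr0.
Qed.

(** [sobolev_ball] says nothing about [f] off the cube; measurability of [f] on the whole space is
    added so that the loss events are measurable and the threshold can be lowered by
    monotonicity. *)
Definition large_loss (b p : nat) (L T : R) (fhat : observations d N -> 'rV[R]_d -> R) :=
  exists f (Q : index -> probability (measurableTypeR R) R), 
    [/\ sobolev_ball b p L f, measurable_fun setT f &
    ((4%:R^-1)%:E <= huber_law heps f Q
      [set y | (T%:E <= sq_L2_norm (fun x => fhat y x - f x)%R)%E])%E].

Lemma large_loss_le b p (L T T' : R) (fhat : observations d N -> 'rV[R]_d -> R) :
  estimator d N fhat -> T <= T' -> large_loss b p L T' fhat -> large_loss b p L T fhat.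
Proof.
move=> mfhat TT' [f [Q [fL mf H]]]; exists f, Q; split => //.
have mloss := measurable_cell_loss mfhat (@measurable_unit_cube R d) (subset_refl _) mf.
have mset (S : R) : measurable [set y | (S%:E <= sq_L2_norm (fun x => fhat y x - f x)%R)%E].
  by rewrite -[X in measurable X]setTI; apply: emeasurable_fun_c_infty => //; exact: mloss.
apply: le_trans H _; apply: le_measure; rewrite ?inE//.
by move=> y /=; apply: le_trans; rewrite lee_fin.
Qed.

(** The two-point method, obtained as the hypercube argument with a single cell, the whole cube, of
    volume 1. *)
Lemma large_loss_constants b p (L a : R) (Q : bool -> index -> probability (measurableTypeR R) R)
    (fhat : observations d N -> 'rV[R]_d -> R) :
  estimator d N fhat -> (0 < b)%N -> (0 < p)%N -> 0 <= L -> 0 < a ->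
  (forall (c : bool) A, measurable A ->
    (huber_law heps (cst (c%:R * a)%R) (Q c) A * huber_law heps (cst (c%:R * a)%R) (Q c) A <=
     (3 / 2)%:E * huber_law heps (cst ((~~ c)%:R * a)%R) (Q (~~ c)) A)%E) ->
  large_loss b p L (a ^+ 2 / 64) fhat.
Proof.
move=> mfhat b0 p0 L0 a0 lawQ.
have := @hypercube_lower_bound R d N eps heps unit
  (fun w => cst ((w tt)%:R * a)) (fun w => Q (w tt)) (fun=> unit_cube d) (fun=> cst a) a 1.
move=> /(_ _ _ _ _ _ _ a0 ltr01 _ _ _ _ _ mfhat)[] //.
- by move=> _; exact: measurable_unit_cube.
- by move=> _ x.
- by move=> [] [].
- by move=> _; exact: lebesgue_rV_unit_cube.
- by move=> w [].
- by rewrite card_unit.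
- by move=> w [] A mA; rewrite ffunE eqxx; exact: lawQ.
move=> w; rewrite card_unit mul1r mulr1 => H.
by exists (cst ((w tt)%:R * a)), (Q (w tt)); split => //; exact: sobolev_ball_cst.
Qed.

Lemma large_loss_contamination b p (L : R) (fhat : observations d N -> 'rV[R]_d -> R) :
  estimator d N fhat -> (0 < b)%N -> (0 < p)%N -> 0 <= L ->
  large_loss b p L ((eps / 4) ^+ 2 / 64) fhat.
Proof.
move=> mfhat b0 p0 L0; have [e0 e1] := andP heps.
have [Q0 [Q1 Q01]] := huber_mixture_indistinguishable heps.
pose Q (c : bool) (_ : index) := if c then Q1 else Q0.
apply: (@large_loss_constants b p L (eps / 4) Q) => // [|c A mA]; first by rewrite divr_gt0.
have mix i B : measurable B -> huber_mixture heps (c%:R * (eps / 4)) (Q c i) B =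
    huber_mixture heps ((~~ c)%:R * (eps / 4)) (Q (~~ c) i) B.
  by move=> mB; case: c => /=; rewrite ?mul1r ?mul0r Q01.
have dom : chi2_dominated (\prod_(j < #|{: index}|) 1)
    (huber_law heps (cst (c%:R * (eps / 4))) (Q c))
    (huber_law heps (cst ((~~ c)%:R * (eps / 4))) (Q (~~ c))).
  apply: chi2_dominated_product => // j.
  apply: (@chi2_dominated_refl _ _ _ _
    (huber_mixture heps ((~~ c)%:R * (eps / 4)) (Q (~~ c) (enum_val j)))) => B mB.
  exact: mix.
apply: le_trans (chi2_dominated_set mA dom) _.
by apply: lee_wpmul2r => //; rewrite big1// lee_fin; lra.
Qed.

Lemma large_loss_noise b p (L a : R) (fhat : observations d N -> 'rV[R]_d -> R) :
  estimator d N fhat -> (0 < b)%N -> (0 < p)%N -> 0 <= L -> 0 < a ->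
  (N ^ d)%:R * a ^+ 2 <= 1 / 4 -> large_loss b p L (a ^+ 2 / 64) fhat.
Proof.
move=> mfhat b0 p0 L0 a0 aN.
apply: (@large_loss_constants b p L a (fun c => clean_noise (cst (c%:R * a)))) => // c A mA.
apply: huber_law_clean_dominated => //; apply: le_trans aN.
rewrite (eq_bigr (fun=> a ^+ 2)) => [|i _]; last by case: c => /=; ring.
by rewrite sumr_const card_ffun !card_ord -[leLHS]mulr_natl.
Qed.

(** The [K^d] inner cells of volume [(2 K)^(-d)] fill a fraction [2^(-d)] of the cube, so [K]
    affects the loss only through the admissible height [A]. *)
Lemma large_loss_bumps b p K (L A B : R) (fhat : observations d N -> 'rV[R]_d -> R) :
  estimator d N fhat -> (0 < d)%N -> (0 < p)%N -> 0 < A -> 1 <= B ->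
  (forall i t, (i <= b)%N -> `|bump b i t| <= B) ->
  (0 < K <= N)%N ->
  #|multi_index d b|%:R * (A * K%:R ^+ b * B ^+ d) <= L ->
  ((K < N)%N -> A ^+ 2 * (2 * (N%:R / K%:R)) ^+ d <= 1 / 4) ->
  large_loss b p L ((A * ((3 / 4) ^+ b.+1) ^+ d) ^+ 2 / 2 ^+ d / 64) fhat.
Proof.
move=> mfhat d0 p0 A0 B1 bumpB /andP[K0 KN] AL AN.
have Kr0 : 0 < K%:R :> R by rewrite ltr0n.
pose cell := bump_cell d K; pose c : R := ((3 / 4) ^+ b.+1) ^+ d.
have c0 : 0 < c by rewrite !exprn_gt0//; lra.
pose f (w : {ffun cell -> bool}) := bump_wave b A w (fun=> 0%N).
have e0 : 0 < A * c by rewrite mulr_gt0.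
have v0 : 0 < (2 * K%:R)^-1 ^+ d :> R by rewrite exprn_gt0// invr_gt0 mulr_gt0.
have := @hypercube_lower_bound R d N eps heps cell f (fun w => clean_noise (f w))
  (@inner_cell R d K) (fun k x => A * bump_prod b (fun=> 0%N) k x) (A * c) ((2 * K%:R)^-1 ^+ d).
move=> /(_ _ _ _ _ _ _ e0 v0 _ _ _ _ _ mfhat)[].
- by move=> w; apply: continuous_measurable_rV; exact: continuous_bump_wave.
- move=> k; apply: continuous_measurable_rV => x.
  by apply: (@continuousM _ _ (cst A)); [exact: cst_continuous|exact: continuous_bump_prod].
- by move=> k; exact: measurable_inner_cell.
- by move=> k; exact: inner_cell_sub.
- by move=> k k' x; exact: (trivIset_inner_cell b).
- by move=> k; exact: lebesgue_rV_inner_cell.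
- by move=> k x kx; rewrite ler_pM2l//; exact: bump_prod_inner_ge.
- by move=> w k x kx; rewrite /f (bump_wave_inner _ _ _ kx) mulrCA.
- by rewrite card_ffun !card_ord expn_gt0 K0.
- move=> w k D mD; apply: huber_law_clean_dominated => //.
  rewrite (eq_bigr (fun i : index => A ^+ 2 * bump_prod b (fun=> 0%N) k (design_point i) ^+ 2)); last first.
    by move=> i _; rewrite /f bump_wave_flip.
  rewrite -mulr_sumr; apply: (@le_trans _ _ (A ^+ 2 *
      if (K < N)%N then (2 * (N%:R / K%:R)) ^+ d else 0)).
    by apply: ler_wpM2l; [exact: sqr_ge0|exact: sum_bump_prod_design].
  by case: ifPn => [/AN//|_]; rewrite mulr0.
move=> w H; exists (f w), (clean_noise (f w)); split.
- by apply: (bump_wave_sobolev_ball (B := B)) => //; exact: ltW.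
- by apply: continuous_measurable_rV; exact: continuous_bump_wave.
move: H; have -> : #|cell| = (K ^ d)%N by rewrite card_ffun !card_ord.
suff -> : (K ^ d)%:R * ((A * c) ^+ 2 * (2 * K%:R)^-1 ^+ d) = (A * c) ^+ 2 / 2 ^+ d by [].
rewrite natrX exprVn [(2 * K%:R) ^+ d]exprMn.
have Kd0 : K%:R ^+ d != 0 :> R by rewrite expf_neq0// gt_eqF.
by rewrite invfM mulrCA; congr (_ * _); rewrite mulrCA mulfV ?mulr1.
Qed.

End risk.

(** Since [- 2 b / E = d / E - 1], the rate is [s^d / n]; real exponents are confined to this lemma
    and the later comparisons use integer powers of [s]. *)
Lemma minimax_rateE (R : realType) (d b : nat) (L n : R) : 0 < L -> 0 < n ->
  let E := (2 * b + d)%N in (0 < E)%N ->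
  let s := (L `^ E%:R^-1) ^+ 2 * n `^ E%:R^-1 in
  [/\ 0 < s, s ^+ E = L ^+ 2 * n &
   (L `^ E%:R^-1) ^+ (2 * d) * n `^ (- ((2 * b)%:R / E%:R)) = s ^+ d / n].
Proof.
move=> L0 n0 E E0 s; have Er0 : E%:R != 0 :> R by rewrite pnatr_eq0 -lt0n.
have powE (x : R) : 0 < x -> (x `^ E%:R^-1) ^+ E = x.
  by move=> x0; rewrite -powR_mulrn ?powR_ge0// -powRrM mulVf// powRr1// ltW.
split.
- by rewrite mulr_gt0 ?exprn_gt0 ?powR_gt0.
- by rewrite exprMn exprAC !powE.
- rewrite exprMn -exprM -mulrA; congr (_ * _).
  have -> : - ((2 * b)%:R / E%:R) = E%:R^-1 * d%:R + -1 :> R.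
    by rewrite /E natrD natrM; field; rewrite -natrM -natrD.
  rewrite powRD; last by rewrite (gt_eqF n0) implybT.
  by rewrite powR_inv1 ?(ltW n0)// powRrM powR_mulrn// powR_ge0.
Qed.

(* C is absolute. The "polynomial function" of L is q evaluated at L^(1/m): finitely
   many nonnegative rational powers of L are allowed, and it is positive for L > 0. *)
Theorem theorem5 (R : realType) :
  exists C : R, 0 < C /\
  forall d beta p : nat, (0 < d)%N -> (0 < beta)%N -> (0 < p)%N ->
    p%:R^-1 <= (beta%:R - 1) / d%:R :> R ->
  exists (m : nat) (q : {poly R}),
    (0 < m)%N /\ (forall t : R, 0 < t -> 0 < q.[t]) /\
  forall (L eps : R) (heps : 0 < eps < 1) (N : nat), 0 < L -> (0 < N)%N ->
    ((4%:R^-1)%R%:E <=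
     ereal_inf [set
       ereal_sup [set
         huber_law heps f Q
           [set y : observations d N |
             ((C * (q.[L `^ m%:R^-1] *
                      (N ^ d)%:R `^ (- ((2 * beta)%:R / (2 * beta + d)%:R))
                    + eps ^+ 2))%R%:E
               <= sq_L2_norm (fun x : 'rV[R]_d => fhat y x - f x)%R)%E]
         | f in sobolev_ball beta p L
         & Q in [set: {ffun 'I_d -> 'I_N} -> probability (measurableTypeR R) R]]
       | fhat in estimator d N])%E.
Proof.
(* The contamination bound is [(eps / 4)^2 / 64 = eps^2 / 1024]; a further factor 2 pays for
   bounding a sum by twice its larger term. *)
exists (1 / 2048); split; first by lra.
move=> d b p d0 b0 p0 _; have [B [B1 bumpB]] := @bump_bounded R b.
pose E := (2 * b + d)%N; have E0 : (0 < E)%N by rewrite addn_gt0 d0 orbT.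
pose m : R := #|multi_index d b|%:R.
have m1 : 1 <= m by rewrite ler1n; apply/card_gt0P; exists [ffun=> ord0].
have B0 : 0 < B ^+ d by rewrite exprn_gt0// (lt_le_trans ltr01).
have Bd1 : 1 <= B ^+ d by rewrite exprn_ege1.
have t0 : 0 < 2 ^+ d :> R by rewrite exprn_gt0.
have t1 : 1 <= 2 ^+ d :> R by rewrite exprn_ege1// ler1n.
(* Small enough for two purposes: [m * B ^+ d * a0 <= 1] keeps the wave in the Sobolev ball, and
   [a0 * 2 ^+ d <= 1 / 2] keeps the means within the 1/4 that the domination allows. *)
pose a0 : R := (m * B ^+ d * (2 * 2 ^+ d))^-1.
have den0 : 0 < m * B ^+ d * (2 * 2 ^+ d) by rewrite !mulr_gt0// (lt_le_trans ltr01).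
have a00 : 0 < a0 by rewrite invr_gt0.
pose cb : R := ((3 / 4) ^+ b.+1) ^+ d.
have cb0 : 0 < cb by rewrite !exprn_gt0//; lra.
have cb1 : cb <= 1 by rewrite !exprn_ile1// ?exprn_ge0//; lra.
have a01 : a0 * 2 ^+ d <= 1 / 2.
  rewrite mulrC ler_pdivrMr//.
  have : 2 ^+ d <= m * B ^+ d * 2 ^+ d by rewrite ler_peMl ?(ltW t0)// mulr_ege1.
  lra.
have a0_le1 : a0 <= 1.
  by apply: (@le_trans _ _ (a0 * 2 ^+ d)); [rewrite ler_peMr// ltW|lra].
(* The factor [4 ^+ b] pays for [K <= 2 s] in [K ^+ (2 * b)]; the others are those of the loss in
   [large_loss_bumps]. The noise case uses [c <= 1]. *)
pose c : R := a0 ^+ 2 * cb ^+ 2 / (4 ^+ b * 2 ^+ d).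
have c0 : 0 < c by rewrite divr_gt0 ?mulr_gt0 ?exprn_gt0.
have c1 : c <= 1.
  rewrite ler_pdivrMr ?mulr_gt0 ?exprn_gt0// mul1r.
  apply: (@le_trans _ _ 1); last first.
    by rewrite mulr_ege1// exprn_ege1// ler1n.
  by apply: mulr_ile1; rewrite ?sqr_ge0// expr_le1// ltW.
(* At [L^(1 / E)] this gives [c * L^(2 d / E)], the power of [L] contained in [s ^+ d]. *)
exists E, (c *: 'X^(2 * d)); split=> //; split.
  by move=> t tt0; rewrite !hornerE mulr_gt0// exprn_gt0.
move=> L eps heps N L0 N0; apply: le_ereal_inf_tmp => _ [fhat mfhat <-].
suff [f [Q [fL _ H]]] : large_loss heps b p L (1 / 2048 *
    ((c *: 'X^(2 * d)).[L `^ E%:R^-1] *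
     (N ^ d)%:R `^ (- ((2 * b)%:R / (2 * b + d)%:R)) + eps ^+ 2)) fhat.
  apply: le_trans H _; apply: ereal_sup_ubound.
  by exists f => //; exists Q.
have n0 : 0 < (N ^ d)%:R :> R by rewrite ltr0n expn_gt0 N0.
have [] := @minimax_rateE R d b L (N ^ d)%:R L0 n0 E0.
rewrite -/E; set s := (X in 0 < X) => s0 sE rateE.
rewrite !hornerE -mulrA rateE; set n : R := (N ^ d)%:R in n0 sE *.
have [tau_eps|eps_tau] := leP (c * (s ^+ d / n)) (eps ^+ 2).
  apply: large_loss_le (large_loss_contamination heps mfhat b0 p0 (ltW L0)) => //.
  by rewrite expr_div_n; lra.
have [s1|s1] := leP 1 s; last first.
  (* This distance makes [n * a^2] equal to 1/4, the most that [large_loss_noise] allows. *)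
  have a0' : 0 < (2 * Num.sqrt n)^-1 by rewrite invr_gt0 mulr_gt0// sqrtr_gt0.
  have a2 : (2 * Num.sqrt n)^-1 ^+ 2 = (4 * n)^-1.
    by rewrite exprVn exprMn sqr_sqrtr ?(ltW n0)// expr2 -natrM.
  apply: large_loss_le (large_loss_noise heps mfhat b0 p0 (ltW L0) a0' _) => //; last first.
    by rewrite a2 (_ : _ * _ = 1 / 4)//; field; rewrite gt_eqF.
  rewrite a2; have : c * (s ^+ d / n) <= n^-1.
    rewrite mulrA ler_piMl ?invr_ge0 ?(ltW n0)//.
    by apply: mulr_ile1; rewrite ?exprn_ge0 ?exprn_ile1 ?(ltW c0)// ltW.
  have ninv : 0 < n^-1 by rewrite invr_gt0.
  rewrite invfM; lra.
(* As [1 <= s], [K <= 2 s] always holds, which is what the size of the loss needs; [s < K] holds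
   when [K < N], the case where indistinguishability needs it. *)
pose K := minn (Num.truncn s).+1 N.
have K0 : (0 < K <= N)%N by rewrite leq_min geq_minr N0.
have Kr0 : 0 < K%:R :> R by rewrite ltr0n; case/andP: K0.
have K2s : K%:R <= 2 * s.
  have : K%:R <= (Num.truncn s).+1%:R :> R by rewrite ler_nat geq_minl.
  have := truncn_le s; rewrite (ltW s0) -natr1; lra.
have sK : (K < N)%N -> s < K%:R.
  rewrite /K gtn_min ltnn orbF => aN.
  by rewrite (minn_idPl (ltnW aN)) truncnS_gt.
pose A := a0 * L / K%:R ^+ b.
have A0 : 0 < A by rewrite divr_gt0 ?mulr_gt0 ?exprn_gt0.
have A2 : A ^+ 2 = a0 ^+ 2 * L ^+ 2 / K%:R ^+ (2 * b).
  by rewrite /A expr_div_n exprMn -exprM mulnC.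
have AL : m * (A * K%:R ^+ b * B ^+ d) <= L.
  rewrite /A mulfVK ?expf_neq0 ?gt_eqF//.
  have -> : m * (a0 * L * B ^+ d) = L * (m * B ^+ d * a0) by ring.
  rewrite ler_piMr ?(ltW L0)// /a0 ler_pdivrMr// mul1r ler_peMr//.
    by rewrite mulr_ge0 ?(ltW B0)// (le_trans ler01).
  lra.
have AN : (K < N)%N -> A ^+ 2 * (2 * (N%:R / K%:R)) ^+ d <= 1 / 4.
  move=> /sK sKlt.
  (* [L ^+ 2 * n = s ^+ E] leaves a constant times [(s / K) ^+ E], and [s < K]. *)
  have -> : A ^+ 2 * (2 * (N%:R / K%:R)) ^+ d =
      (a0 ^+ 2 * 2 ^+ d) * (s ^+ E / K%:R ^+ E).
    rewrite A2 sE exprMn expr_div_n /E exprD /n natrX.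
    by field; rewrite !expf_neq0 ?gt_eqF.
  apply: (@le_trans _ _ (1 / 4 * 1)); last by rewrite mulr1.
  apply: ler_pM.
  - by rewrite mulr_ge0 ?exprn_ge0// ltW.
  - by rewrite divr_ge0 ?exprn_ge0// ltW.
  - apply: (@le_trans _ _ ((a0 * 2 ^+ d) ^+ 2)).
      by rewrite exprMn ler_wpM2l ?sqr_ge0// expr2 ler_peMr// ltW.
    have -> : 1 / 4 = (1 / 2) ^+ 2 :> R by field.
    by rewrite lerXn2r ?nnegrE// mulr_ge0 ?(ltW a00)// ltW.
  - rewrite ler_pdivrMr ?exprn_gt0// mul1r lerXn2r ?nnegrE ?(ltW s0) ?(ltW Kr0)//.
    exact: ltW.
apply: large_loss_le (large_loss_bumps heps mfhat d0 p0 A0 B1 bumpB K0 AL AN) => //.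
suff H : c * (s ^+ d / n) <= (A * cb) ^+ 2 / 2 ^+ d.
  by move: H eps_tau (sqr_ge0 eps); rewrite -/cb; lra.
rewrite [(A * cb) ^+ 2]exprMn A2.
(* Eliminating [L] isolates the target [s ^+ d / n]; the remaining factor [(s / K) ^+ (2 * b)] is at
   least [4^(-b)]. *)
have -> : L ^+ 2 = s ^+ (2 * b) * s ^+ d / n.
  by rewrite -exprD sE mulfK ?gt_eqF.
have -> : a0 ^+ 2 * (s ^+ (2 * b) * s ^+ d / n) / K%:R ^+ (2 * b) * cb ^+ 2 / 2 ^+ d =
    (s ^+ (2 * b) / K%:R ^+ (2 * b)) * (a0 ^+ 2 * cb ^+ 2 / 2 ^+ d * (s ^+ d / n)).
  by field; rewrite !expf_neq0 ?gt_eqF.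
have -> : c * (s ^+ d / n) = (4 ^+ b)^-1 * (a0 ^+ 2 * cb ^+ 2 / 2 ^+ d * (s ^+ d / n)).
  by rewrite /c; field; rewrite !expf_neq0 ?gt_eqF.
apply: ler_wpM2r.
  by rewrite !mulr_ge0 ?invr_ge0 ?exprn_ge0// ltW.
rewrite ler_pdivlMr ?exprn_gt0// mulrC ler_pdivrMr ?exprn_gt0//.
have -> : s ^+ (2 * b) * 4 ^+ b = (2 * s) ^+ (2 * b).
  have -> : 4 = 2 ^+ 2 :> R by rewrite -natrX.
  by rewrite -exprM [RHS]exprMn mulrC.
by rewrite lerXn2r ?nnegrE ?(ltW Kr0)// (le_trans (ltW Kr0)).
Qed.
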